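(* Let $G$ be a finite abelian subgroup of $SL(3,\mathbb{C})$. Then a crepant iterated Fujiki-Oka resolution exists for $\mathbb{C}^3/G$.
   Context: Below $n=3$. $G$ is assumed to consist of diagonal matrices (after conjugation). $\frac1r(a_1,\dots,a_n)$, $0\le a_i<r$, denotes the matrix $\mathrm{diag}(e^{2\pi\sqrt{-1}a_1/r},\dots,e^{2\pi\sqrt{-1}a_n/r})$ as well as the vector $(a_1/r,\dots,a_n/r)$. For a finite diagonal group $H$ put $N_H=\mathbb{Z}^n+\sum_{\frac1r(a_1,\dots,a_n)\in H}\mathbb{Z}\,\frac1r(a_1,\dots,a_n)$. With $\sigma=\mathbb{R}^n_{\ge0}$, $\mathbb{C}^n/H$ is the toric variety $X(N_H,\sigma)$. For $v\in\mathbb{R}^n$, $\mathrm{age}(v)=\sum_i v_i$. Crepancy. For a smooth (with respect to $N_G$) fan $\Sigma$ subdividing $\sigma$, the divisor of a ray $\tau\in\Sigma$ has discrepancy $\mathrm{age}(A_\tau)-1$, $A_\tau$ being the primitive generator of $\tau$ in $N_G$; the resolution $X(N_G,\Sigma)\to X(N_G,\sigma)$ is crepant if all discrepancies vanish, i.e. every $A_\tau$ has age $1$. Fujiki-Oka subdivision. Fix a lattice $M\subset\mathbb{R}^n$ of rank $n$. An $n$-dimensional simplicial cone $\tau$ with primitive generators $P_1,\dots,P_n\in M$ is semi-unimodular over $P_1$ (after reordering the generators, any of them can play this role) if $P_2,\dots,P_n$ is part of a $\mathbb{Z}$-basis of $M$. Let $s=[M:\bigoplus\mathbb{Z}P_i]$.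 If $s>1$ there are unique integers $0\le b_i\le s-1$ such that the Oka center $C=\frac1s(P_1+\sum_{i\ge2}b_iP_i)$ lies in $M$ and $C,P_2,\dots,P_n$ is a $\mathbb{Z}$-basis of $M$. Star-subdividing $\tau$ at $C$ gives the smooth cone on $C,P_2,\dots,P_n$ and, for each $i\ge 2$ with $b_i\ne0$, the cone $\tau_i$ obtained by replacing $P_i$ by $C$; $\tau_i$ is again semi-unimodular over $P_1$, of index $b_i$. Repeating (always over $P_1$) until all maximal cones are smooth gives the Fujiki-Oka subdivision of $\tau$. If $s=1$, $\tau$ is left unchanged. Iterated Fujiki-Oka resolutions. A sequence of iterated Fujiki-Oka resolutions for $\mathbb{C}^n/G$ consists of a chain of subgroups $H_1\subset H_2\subset\dots\subset H_k=G$, with $H_1$ cyclic and each $H_{i}$ a direct factor of $H_{i+1}$ (a component of a decomposition of $H_{i+1}$ into cyclic subgroups), together with fans $\Sigma_1,\dots,\Sigma_k$ as follows. Put $\Sigma_0=\{\text{faces of }\sigma\}$. For each $i=1,\dots,k$, all maximal cones of $\Sigma_{i-1}$ are semi-unimodular with respect to the lattice $N_{H_i}$ over some generator, and $\Sigma_i$ is the fan obtained by replacing each maximal cone of $\Sigma_{i-1}$ by its Fujiki-Oka subdivision with respect to $N_{H_i}$ over a chosen such generator. The resolution $\widetilde{Y_G}=X(N_G,\Sigma_k)\to\mathbb{C}^n/G$ is called an iterated Fujiki-Oka resolution of $\mathbb{C}^n/G$. The case $k=1$ is the ordinary Fujiki-Oka resolution. *)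

(* Defs.v *)
From HB Require Import structures.
From mathcomp Require Import all_boot all_order all_algebra all_fingroup.
From mathcomp Require Import all_solvable mxrepresentation complex.
From mathcomp Require Import all_classical all_reals all_analysis.

Set Implicit Arguments.
Unset Strict Implicit.
Unset Printing Implicit Defensive.

Import Order.TTheory GRing.Theory Num.Theory.
Local Open Scope classical_set_scope.
Local Open Scope complex_scope.
Local Open Scope ring_scope.

Section Lattices.
Variables (R : realType) (n : nat).
Local Notation V := 'rV[R]_n.

Definition Zspan (A : set V) : set V :=
  [set x | exists (m : nat) (z : 'I_m -> int) (v : 'I_m -> V),
     (forall i, A (v i)) /\ x = \sum_(i < m) v i *~ z i].

Definition Zbasis (M : set V) (B : seq V) : Prop :=
  free B /\ M = Zspan [set` B].

Definition primitive (M : set V) (P : V) : Prop :=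
  [/\ M P, P <> 0 & forall (Q : V) (k : nat), M Q -> P = Q *+ k -> k = 1%N].

(* [M : L] = s, witnessed by a complete list t of coset representatives. *)
Definition has_index (M L : set V) (s : nat) : Prop :=
  exists t : 'I_s -> V,
    (forall i, M (t i)) /\ (forall x, M x -> exists! i, L (x - t i)).

Definition age (v : V) : R := \sum_(i < n) v 0 i.

End Lattices.

Section Fans.
Variables (R : realType) (n : nat).
Local Notation V := 'rV[R]_n.

Definition cone (s : seq V) : set V :=
  [set x | exists c : 'I_(size s) -> R,
     (forall i, 0 <= c i) /\ x = \sum_(i < size s) c i *: s`_i].

Definition orthant : set V := [set x | forall i, 0 <= x 0 i].

(* F is cut out of tau by a supporting hyperplane; u is the linear form. *)
Definition face (tau F : set V) : Prop :=
  exists u : 'cV[R]_n,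
    (forall x, tau x -> 0 <= (x *m u) 0 0) /\
    F = [set x | tau x /\ (x *m u) 0 0 = 0].

(* A fan is given by all of its cones, as subsets of R^n, not only by the
   maximal ones. *)
Definition is_fan (M : set V) (Sigma : set (set V)) : Prop :=
  [/\ finite_set Sigma,
      forall tau, Sigma tau ->
        (exists s : seq V, (forall v, v \in s -> M v) /\ tau = cone s) /\
        (forall x, tau x -> tau (- x) -> x = 0),
      forall tau F, Sigma tau -> face tau F -> Sigma F
    & forall tau1 tau2, Sigma tau1 -> Sigma tau2 ->
        face tau1 (tau1 `&` tau2) /\ face tau2 (tau1 `&` tau2)].

Definition maximal_cone (Sigma : set (set V)) (tau : set V) : Prop :=
  Sigma tau /\ forall tau', Sigma tau' -> tau `<=` tau' -> tau' = tau.

Definition subdivides (Sigma : set (set V)) (sigma : set V) : Prop :=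
  \bigcup_(tau in Sigma) tau = sigma.

Definition smooth_fan (M : set V) (Sigma : set (set V)) : Prop :=
  forall tau, Sigma tau ->
    exists s B : seq V, [/\ Zbasis M B, {subset s <= B} & tau = cone s].

Definition discrepancy (A : V) : R := age A - 1.

Definition crepant_resolution (M : set V) (Sigma : set (set V)) : Prop :=
  [/\ is_fan M Sigma, smooth_fan M Sigma, subdivides Sigma orthant
    & forall A, primitive M A -> Sigma (cone [:: A]) -> discrepancy A = 0].

End Fans.

Section FujikiOka.
Variables (R : realType) (n : nat).
Local Notation V := 'rV[R]_n.

(* The cone on P1, P2, ..., Pn is passed as the distinguished generator P1
   together with the list Ps = [:: P2; ...; Pn]. *)
Definition semi_unimodular (M : set V) (P1 : V) (Ps : seq V) : Prop :=
  [/\ (size Ps).+1 = n, free (P1 :: Ps),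
      (forall P, P \in P1 :: Ps -> primitive M P)
    & exists B, Zbasis M B /\ {subset Ps <= B}].

Definition cone_index (M : set V) (P1 : V) (Ps : seq V) (s : nat) : Prop :=
  has_index M (Zspan [set` P1 :: Ps]) s.

Definition oka_center (M : set V) (P1 : V) (Ps : seq V)
    (s : nat) (b : nat -> nat) (C : V) : Prop :=
  [/\ cone_index M P1 Ps s /\ (1 < s)%N,
      forall i, (i < size Ps)%N -> (b i <= s - 1)%N,
      C = s%:R^-1 *: (P1 + \sum_(i < size Ps) (b i)%:R *: Ps`_i),
      M C
    & Zbasis M (C :: Ps)].

(* FO_cone M P1 Ps Q: the cone on the generators Q is a maximal cone of the
   Fujiki-Oka subdivision over P1 of the cone on P1 :: Ps, assumed to be
   semi-unimodular over P1. The index decreases along FO_replace, so this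
   least fixpoint lists the outcome of the terminating procedure. *)
Inductive FO_cone (M : set V) (P1 : V) : seq V -> seq V -> Prop :=
| FO_unchanged Ps :
    cone_index M P1 Ps 1 -> FO_cone M P1 Ps (P1 :: Ps)
| FO_smooth Ps s b C :
    oka_center M P1 Ps s b C -> FO_cone M P1 Ps (C :: Ps)
| FO_replace Ps s b C i Q :
    oka_center M P1 Ps s b C -> (i < size Ps)%N -> b i <> 0%N ->
    FO_cone M P1 (set_nth 0 Ps i C) Q -> FO_cone M P1 Ps Q.

(* The distinguished generator may be chosen differently in each maximal cone;
   that the subdivided cones fit together into a fan is a requirement. *)
Definition FO_step (M : set V) (Sigma Sigma' : set (set V)) : Prop :=
  exists (P1 : set V -> V) (Ps : set V -> seq V),
    [/\ forall tau, maximal_cone Sigma tau ->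
          tau = cone (P1 tau :: Ps tau) /\ semi_unimodular M (P1 tau) (Ps tau),
        Sigma' = [set F | exists (tau : set V) (Q : seq V),
                    [/\ maximal_cone Sigma tau, FO_cone M (P1 tau) (Ps tau) Q
                      & face (cone Q) F]]
      & is_fan M Sigma'].

End FujikiOka.

Section DiagonalGroups.
Variables (R : realType) (n : nat) (gT : finGroupType).
Local Notation V := 'rV[R]_n.

Definition weight_mx (r : nat) (a : 'I_n -> nat) : 'M[R[i]]_n :=
  diag_mx (\row_j (cos (2 * pi * (a j)%:R / r%:R) +i*
                   sin (2 * pi * (a j)%:R / r%:R))).

Definition weight_vec (r : nat) (a : 'I_n -> nat) : V :=
  \row_j ((a j)%:R / r%:R).

Definition std_basis : set V := [set x | exists j, x = delta_mx 0 j].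

Definition group_weights (D : gT -> 'M[R[i]]_n) (H : {set gT}) : set V :=
  [set x | exists (r : nat) (a : 'I_n -> nat),
     [/\ forall j, (a j < r)%N,
         exists2 g, g \in H & D g = weight_mx r a
       & x = weight_vec r a]].

(* The lattice N_H of the diagonal group formed by the D g with g in H. *)
Definition group_lattice (D : gT -> 'M[R[i]]_n) (H : {set gT}) : set V :=
  Zspan (std_basis `|` group_weights D H).

(* H is the product of some of the components in a decomposition of H' as an
   internal direct product of cyclic subgroups. *)
Definition direct_factor (H H' : {set gT}) : Prop :=
  exists b1 b2 : seq gT,
    (\big[dprod/1]_(x <- b1) <[x]> = H)%g /\
    (\big[dprod/1]_(x <- b1 ++ b2) <[x]> = H')%g.

(* H and Sigma are only relevant at the indices 1..k and 0..k respectively. *)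
Definition iterated_FO (D : gT -> 'M[R[i]]_n) (G : {group gT}) (k : nat)
    (H : nat -> {group gT}) (Sigma : nat -> set (set V)) : Prop :=
  [/\ (0 < k)%N /\ H k = G,
      cyclic (H 1%N),
      forall i, (0 < i < k)%N -> direct_factor (H i) (H i.+1),
      Sigma 0%N = face (@orthant R n)
    & forall i, (i < k)%N ->
        FO_step (group_lattice D (H i.+1)) (Sigma i) (Sigma i.+1)].

Definition crepant_iterated_FO_exists
    (D : gT -> 'M[R[i]]_n) (G : {group gT}) : Prop :=
  exists (k : nat) (H : nat -> {group gT}) (Sigma : nat -> set (set V)),
    iterated_FO D G k H Sigma /\
    crepant_resolution (group_lattice D G) (Sigma k).

Definition conj_repr (G : {group gT}) (rG : mx_representation R[i] G n)
    (P : 'M[R[i]]_n) : gT -> 'M[R[i]]_n :=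
  fun g => P *m rG g *m invmx P.

Definition diagonalizes (G : {group gT}) (rG : mx_representation R[i] G n)
    (P : 'M[R[i]]_n) : Prop :=
  P \in unitmx /\ forall g, g \in G -> is_diag_mx (conj_repr rG P g).

End DiagonalGroups.

(* Main.v *)
(* A lattice vector of a subgroup of SL has integral age. Decompose G into
   cyclic groups of prime power order and adjoin them one at a time. All maximal
   cones before a step are spanned by a basis P1, P2, P3, of age one, of the
   lattice N, and the new lattice is N' = N + Z w with q w = a P1 + b P2 + c P3
   for a prime power q; taking q minimal, one of a, b, c is prime to q, say a,
   and then P2, P3 extend to a basis of N'. This is where prime powers matter:
   the cyclic group 1/30(2,3,25) is not semi-unimodular over any generator.

   The Oka center (P1 + b2 P2 + b3 P3) / s has integral age strictly between 0
   and 2, so its age is one, and this persists through the subdivision. The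
   subdivided cones fit together whatever generators were chosen: a segment
   joining two vectors of age one is cut by a crepant unimodular subdivision at
   exactly its lattice points. *)

Require Import Defs.
From HB Require Import structures.
From mathcomp Require Import all_boot all_order all_algebra all_fingroup.
From mathcomp Require Import all_solvable mxrepresentation complex.
From mathcomp Require Import all_classical all_reals all_analysis.
From mathcomp Require Import ring lra zify.

Set Implicit Arguments.
Unset Strict Implicit.
Unset Printing Implicit Defensive.

Import Order.TTheory GRing.Theory Num.Theory.
Local Open Scope classical_set_scope.
Local Open Scope complex_scope.
Local Open Scope ring_scope.

(** * Simplicial cones and fans *)

(** Dimension three enters twice. With [n] generators of age one an Oka center has age below
    [n - 1], so integrality forces age one only because [n = 3]. And two distinct maximal cones
    share at most a two-dimensional face, whose slice of age one is a segment; there the lattice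
    alone dictates the subdivision, whereas a polygon would admit many. This is needed because
    distinguished generators are chosen cone by cone, without coordination between neighbours. Cones
    are handled through lists of generators and coefficient functions on the whole space: two lists
    fit together when every common point has the same coefficient function over both. This passes to
    faces and turns questions on intersections into equalities of functions. *)

Section Cones.
Variables (R : realType) (n : nat).
Local Notation V := 'rV[R]_n.
Implicit Types (Q : seq V) (x v w : V) (u : 'cV[R]_n) (c : V -> R).

Definition pairing u x : R := (x *m u) 0 0.

Fact pairing_is_scalar u : scalar (pairing u).
Proof. by move=> a x y; rewrite /pairing mulmxDl -scalemxAl !mxE. Qed.

HB.instance Definition _ u :=
  GRing.isLinear.Build R V R *%R (pairing u) (pairing_is_scalar u).

Lemma functional_exists Q (f : V -> R) :
  free Q -> exists u, forall v, v \in Q -> pairing u v = f v.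
Proof.
move=> freeQ.
pose phi x : R := \sum_(i < size Q) f Q`_i * coord (in_tuple Q) i x.
exists (\col_j phi (delta_mx 0 j)) => v vQ.
transitivity (phi v).
  rewrite /pairing mxE {2}[v]row_sum_delta /phi.
  under [RHS]eq_bigr do rewrite linear_sum /= mulr_sumr.
  rewrite exchange_big /=; apply: eq_bigr => j _; rewrite mxE mulr_sumr.
  by apply: eq_bigr => i _; rewrite linearZ /= mulrCA.
have lti : (index v Q < size Q)%N by rewrite index_mem.
rewrite /phi (bigD1 (Ordinal lti)) //= nth_index // big1 ?addr0.
  have := coord_free (Ordinal lti) (Ordinal lti) (X := in_tuple Q) freeQ.
  by rewrite /= nth_index // eqxx => ->; rewrite mulr1.
move=> i /negPf neqi.
have := coord_free (Ordinal lti) i (X := in_tuple Q) freeQ.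
by rewrite /= nth_index // eq_sym neqi => ->; rewrite mulr0.
Qed.

Lemma coef_functional Q w : free Q -> w \in Q ->
  exists2 u, forall v, v \in Q -> pairing u v = (v == w)%:R &
    forall c, pairing u (\sum_(v <- Q) c v *: v) = c w.
Proof.
move=> freeQ wQ; have [u uP] := functional_exists (fun v => (v == w)%:R) freeQ.
exists u => // c; rewrite linear_sum /= (bigD1_seq w) ?free_uniq //=.
rewrite linearZ /= uP // eqxx mulr1 big_seq_cond big1 ?addr0 // => v /andP[vQ].
by rewrite linearZ /= uP // => /negPf->; rewrite mulr0.
Qed.

(* Coefficients are functions on V that vanish off Q, so that combinations over
   different families can be compared. *)
Definition nonneg_comb Q c x : Prop :=
  [/\ forall v, 0 <= c v, forall v, v \notin Q -> c v = 0
    & x = \sum_(v <- Q) c v *: v].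

Lemma coneE Q x : uniq Q -> cone Q x <-> exists c, nonneg_comb Q c x.
Proof.
move=> uQ; split=> [[c [c0 ->]]|[c [c0 _ ->]]]; last first.
  by exists (fun i => c Q`_i); split=> //; rewrite (big_nth 0) big_mkord.
exists (fun v => if insub (index v Q) is Some i then c i else 0); split.
- by move=> v; case: insubP.
- by move=> v; rewrite -index_mem; case: insubP => // i ->.
- rewrite [RHS](big_nth 0) big_mkord; apply: eq_bigr => i _.
  by rewrite index_uniq // valK.
Qed.

Lemma nonneg_comb_inj Q c c' x :
  free Q -> nonneg_comb Q c x -> nonneg_comb Q c' x -> c =1 c'.
Proof.
move=> freeQ [_ c0 xE] [_ c'0 xE'] w.
case: (boolP (w \in Q)) => [wQ|wQ]; last by rewrite c0 ?c'0.
by have [u _ uP] := coef_functional freeQ wQ; rewrite -uP -xE xE' uP.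
Qed.

Lemma nonneg_comb_filter Q (S : pred V) c x :
  nonneg_comb (seq.filter S Q) c x <->
  nonneg_comb Q c x /\ forall v, ~~ S v -> c v = 0.
Proof.
split=> [[c0 cN ->]|[[c0 cN ->] cS]].
  have cS v : ~~ S v -> c v = 0.
    by move=> Sv; apply: cN; rewrite mem_filter (negPf Sv).
  split=> //; split=> // [v vQ|].
    by apply: cN; rewrite mem_filter (negPf vQ) andbF.
  rewrite big_filter [RHS](bigID S) /= [X in _ = _ + X]big1 ?addr0 // => v Sv.
  by rewrite cS ?scale0r.
split=> // [v|].
  by rewrite mem_filter negb_and => /orP[/cS|/cN].
rewrite big_filter (bigID S) /= [X in _ + X]big1 ?addr0 // => v Sv.
by rewrite cS ?scale0r.
Qed.

Lemma nonneg_comb_transfer Q Q' c x : uniq Q -> uniq Q' ->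
  nonneg_comb Q c x -> (forall v, v \notin Q' -> c v = 0) -> nonneg_comb Q' c x.
Proof.
move=> uQ uQ' [c0 cN xE] cN'; split=> //.
rewrite xE (bigID (mem Q')) /= [X in _ + X]big1 ?addr0; last first.
  by move=> v vQ'; rewrite cN' // scale0r.
rewrite [RHS](bigID (mem Q)) /= [X in _ = _ + X]big1 ?addr0; last first.
  by move=> v vQ; rewrite cN // scale0r.
rewrite -big_filter -[RHS]big_filter; apply: perm_big.
apply: uniq_perm => [||v]; try exact: filter_uniq.
by rewrite !mem_filter andbC.
Qed.

Lemma nonneg_comb_perm Q Q' c x :
  perm_eq Q Q' -> nonneg_comb Q c x -> nonneg_comb Q' c x.
Proof.
move=> QQ' [c0 cN ->]; split=> // [v|]; last exact: perm_big.
by rewrite -(perm_mem QQ'); apply: cN.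
Qed.

Lemma cone_perm Q Q' : uniq Q -> perm_eq Q Q' -> cone Q = cone Q'.
Proof.
move=> uQ QQ'; have uQ' : uniq Q' by rewrite -(perm_uniq QQ').
apply/seteqP; split=> x.
  by case/(coneE _ uQ)=> c cP; apply/coneE=> //; exists c; exact: nonneg_comb_perm cP.
case/(coneE _ uQ')=> c cP; apply/coneE=> //; exists c.
by apply: nonneg_comb_perm cP; rewrite perm_sym.
Qed.

Lemma mem_cone Q v : uniq Q -> v \in Q -> cone Q v.
Proof.
move=> uQ vQ; apply/coneE => //; exists (fun w => (w == v)%:R); split=> //.
- by move=> w wQ; case: eqP => // wv; rewrite wv vQ in wQ.
- rewrite (bigD1_seq v) //= eqxx scale1r big1 ?addr0 // => w /negPf->.
  by rewrite scale0r.
Qed.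

Lemma cone_pointed Q x : free Q -> cone Q x -> cone Q (- x) -> x = 0.
Proof.
move=> freeQ; have uQ := free_uniq freeQ.
move=> /(coneE _ uQ) [c cP] /(coneE _ uQ) [c' cP'].
have cc' v : c v = 0.
  case: (boolP (v \in Q)) => [vQ|]; last by case: cP => _ + _; apply.
  have [u _ uP] := coef_functional freeQ vQ.
  case: cP cP' => c0 _ xE [c'0 _ xE'].
  have := uP c'; rewrite -xE' linearN /= xE uP => cE.
  by apply/eqP; rewrite eq_le c0 andbT -oppr_ge0 cE.
by case: cP => _ _ ->; rewrite big1 // => v _; rewrite cc' scale0r.
Qed.

(** A form nonnegative on the cone kills a nonnegative combination exactly when it kills every
    generator occurring in it. Conversely, freeness provides a form that is 0 on the generators in
    [S] and 1 on the others. *)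
Lemma face_coneP Q F : free Q ->
  face (cone Q) F <-> exists S : pred V, F = cone (seq.filter S Q).
Proof.
move=> freeQ; have uQ := free_uniq freeQ; split=> [[u [u0 ->]]|[S ->]].
  exists (fun v => pairing u v == 0).
  have uS : uniq [seq v <- Q | pairing u v == 0] by rewrite filter_uniq.
  apply/seteqP; split=> x.
    case=> /(coneE _ uQ) [c cP] xu; apply/coneE => //; exists c.
    apply/nonneg_comb_filter; split=> // v.
    case: (boolP (v \in Q)) => [vQ uv|]; last by case: cP => _ + _ => /[apply].
    case: cP => c0 _ xE; have: pairing u x = 0 by [].
    rewrite xE linear_sum /= => /eqP; rewrite big_seq psumr_eq0; last first.
      move=> w wQ; rewrite linearZ /= mulr_ge0 //.
      by apply: u0; exact: mem_cone.
    move=> /allP/(_ v vQ); rewrite vQ linearZ /= mulf_eq0 (negPf uv) orbF.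
    by move=> /eqP.
  move=> /(coneE _ uS) [c /nonneg_comb_filter [cP cS]]; split.
    by apply/coneE => //; exists c.
  case: cP => _ _ ->; rewrite -/(pairing _ _) linear_sum big1 //= => v _.
  rewrite linearZ /=; case: (boolP (pairing u v == 0)) => [/eqP ->|/cS ->].
    by rewrite mulr0.
  by rewrite mul0r.
have [u uP] := functional_exists (fun v => (~~ S v)%:R) freeQ.
have uE c x : nonneg_comb Q c x -> pairing u x = \sum_(v <- Q) c v * (~~ S v)%:R.
  case=> _ _ ->; rewrite linear_sum /= big_seq [RHS]big_seq.
  by apply: eq_bigr => v vQ; rewrite linearZ /= uP.
have uS : uniq [seq v <- Q | S v] by rewrite filter_uniq.
exists u; split=> [x /(coneE _ uQ) [c cP]|].
  rewrite -/(pairing _ _) (uE c) //; apply: sumr_ge0 => v _.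
  by case: cP => c0 _ _; rewrite mulr_ge0.
apply/seteqP; split=> x.
  move=> /(coneE _ uS) [c /nonneg_comb_filter [cP cS]]; split.
    by apply/coneE => //; exists c.
  rewrite -/(pairing _ _) (uE c) // big1 // => v _.
  by case: (boolP (S v)) => [|/cS ->]; rewrite /= ?mulr0 ?mul0r.
case=> /(coneE _ uQ) [c cP]; rewrite -/(pairing _ _) (uE c) // => /eqP.
case: (cP) => c0 cN xE.
rewrite psumr_eq0 => [/allP c00|v _]; last by rewrite mulr_ge0.
apply/coneE => //; exists c; apply/nonneg_comb_filter; split=> // v Sv.
case: (boolP (v \in Q)) => [vQ|/cN //].
by have /eqP := c00 v vQ; rewrite Sv mulr1.
Qed.

(* For free families this says that the two cones meet along the cone on the
   common generators. *)
Definition compatible Q Q' : Prop := forall c c' x,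
  nonneg_comb Q c x -> nonneg_comb Q' c' x -> c =1 c'.

Lemma compatible_sym Q Q' : compatible Q Q' -> compatible Q' Q.
Proof. by move=> h c c' x cP cP' v; rewrite (h _ _ _ cP' cP). Qed.

Lemma compatible_perm Q1 Q2 Q1' Q2' :
  perm_eq Q1 Q1' -> perm_eq Q2 Q2' -> compatible Q1 Q2 -> compatible Q1' Q2'.
Proof.
rewrite perm_sym (perm_sym Q2) => p1 p2 h c c' x.
by move=> /(nonneg_comb_perm p1) + /(nonneg_comb_perm p2); apply: h.
Qed.

(** A generator [v] of [Q] has the indicator of [v] as coefficient function over [Q], hence also
    over [Q'], where it would vanish if [v] were not in [Q']. *)
Lemma compatible_cone_sub Q Q' : uniq Q -> uniq Q' ->
  compatible Q Q' -> cone Q `<=` cone Q' -> {subset Q <= Q'}.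
Proof.
move=> uQ uQ' QQ' sub v vQ.
have cP : nonneg_comb Q (fun w => (w == v)%:R) v.
  split=> // [w wQ|]; first by case: eqP => // wv; rewrite wv vQ in wQ.
  rewrite (bigD1_seq v) //= eqxx scale1r big1 ?addr0 // => w /negPf->.
  by rewrite scale0r.
have /(coneE _ uQ') [c' cP'] := sub _ (mem_cone uQ vQ).
apply: contraT => vQ'; have [_ cN _] := cP'.
have := QQ' _ _ _ cP cP' v.
by rewrite cN //= eqxx => /eqP; rewrite oner_eq0.
Qed.

Lemma compatible_filter Q Q' (S S' : pred V) :
  compatible Q Q' -> compatible (seq.filter S Q) (seq.filter S' Q').
Proof.
move=> h c c' x /nonneg_comb_filter [cP _] /nonneg_comb_filter [cP' _].
exact: h cP cP'.
Qed.

Definition fan_of (QQ : set (seq V)) : set (set V) :=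
  [set F | exists2 Q, QQ Q & face (cone Q) F].

Section FanOf.
Variable QQ : set (seq V).
Hypothesis QQ_free : forall Q, QQ Q -> free Q.
Hypothesis QQ_compat : forall Q Q', QQ Q -> QQ Q' -> compatible Q Q'.

Lemma fan_ofP F : fan_of QQ F <->
  exists (Q : seq V) (S : pred V), QQ Q /\ F = cone (seq.filter S Q).
Proof.
split=> [[Q QQQ /face_coneP]|[Q [S [QQQ ->]]]].
  by move=> /(_ (QQ_free QQQ)) [S ->]; exists Q, S.
by exists Q => //; apply/face_coneP; [exact: QQ_free|exists S].
Qed.

Lemma fan_of_cone Q : QQ Q -> fan_of QQ (cone Q).
Proof.
by move=> QQQ; apply/fan_ofP; exists Q, predT; rewrite filter_predT.
Qed.

Lemma finite_fan_of : finite_set QQ -> finite_set (fan_of QQ).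
Proof.
move=> finQ.
(* Faces are indexed by boolean masks, of which each [Q] has finitely many; predicates on the whole
   space would not give finiteness. *)
have -> : fan_of QQ = \bigcup_(Q in QQ)
    ((fun m : (size Q).-tuple bool => cone (mask m Q)) @` setT).
  apply/seteqP; split=> F.
    move=> /fan_ofP [Q [S [QQQ ->]]]; exists Q => //=.
    exists (map_tuple S (in_tuple Q)) => //=.
    by rewrite filter_mask.
  case=> Q QQQ [m _ <-]; apply/fan_ofP.
  exists Q, (fun v => v \in mask m Q); split=> //.
  congr cone; apply/subseq_uniqP; last exact: mask_subseq.
  exact: free_uniq (QQ_free QQQ).
apply: bigcup_finite => // Q _; exact: finite_image.
Qed.

(** The intersection axiom is where compatibility is used: a point of both cones has one coefficient
    function, which vanishes off the common generators, so the intersection is the face that they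
    span. *)
Lemma fan_of_is_fan (M : set V) : finite_set QQ ->
  (forall Q v, QQ Q -> v \in Q -> M v) -> is_fan M (fan_of QQ).
Proof.
move=> finQ QM; split.
- exact: finite_fan_of.
- move=> _ /fan_ofP [Q [S [QQQ ->]]].
  have freeS : free (seq.filter S Q) by apply: filter_free; exact: QQ_free.
  split=> [|x]; last exact: cone_pointed.
  exists (seq.filter S Q); split=> // v; rewrite mem_filter => /andP[_].
  exact: QM.
- move=> _ F /fan_ofP [Q [S [QQQ ->]]] faceF.
  have freeS : free (seq.filter S Q) by apply: filter_free; exact: QQ_free.
  case/(face_coneP _ freeS): faceF => S' ->; apply/fan_ofP; exists Q, (predI S' S).
  by rewrite filter_predI.
suff face1 t1 t2 : fan_of QQ t1 -> fan_of QQ t2 -> face t1 (t1 `&` t2).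
  move=> t1 t2 h1 h2; split; first exact: face1.
  by rewrite setIC; exact: face1.
move=> /fan_ofP [Q [S [QQQ ->]]] /fan_ofP [Q' [S' [QQQ' ->]]].
have freeS : free (seq.filter S Q) by apply: filter_free; exact: QQ_free.
have freeS' : free (seq.filter S' Q') by apply: filter_free; exact: QQ_free.
have comp := compatible_filter (S := S) (S' := S') (QQ_compat QQQ QQQ').
move: freeS freeS' comp; set s := seq.filter S Q; set s' := seq.filter S' Q'.
move=> freeS freeS' comp.
have us := free_uniq freeS; have us' := free_uniq freeS'.
apply/face_coneP => //; exists (mem s').
have us'' : uniq [seq v <- s | mem s' v] by rewrite filter_uniq.
apply/seteqP; split=> x.
  case=> /(coneE _ us) [c cP] /(coneE _ us') [c' cP'].
  apply/coneE => //; exists c; apply/nonneg_comb_filter; split=> // v.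
  by rewrite (comp _ _ _ cP cP') => vs'; case: cP' => _ + _; apply.
move=> /(coneE _ us'') [c /nonneg_comb_filter [cP cN]].
split; apply/coneE => //; exists c => //.
exact: nonneg_comb_transfer cP cN.
Qed.

(** Equal sizes exclude that one listed cone is a proper face of another: an inclusion of cones
    gives an inclusion of generators, and then a permutation by counting. *)
Lemma maximal_cone_fan_of k tau : (forall Q, QQ Q -> size Q = k) ->
  maximal_cone (fan_of QQ) tau <-> exists2 Q, QQ Q & tau = cone Q.
Proof.
move=> QQk; split=> [[/fan_ofP [Q [S [QQQ ->]]] max]|[Q QQQ ->]].
  exists Q => //; rewrite -(max (cone Q)) //; first exact: fan_of_cone.
  have freeQ := QQ_free QQQ; have uQ := free_uniq freeQ.
  have uS : uniq (seq.filter S Q) by rewrite filter_uniq.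
  move=> x /(coneE _ uS) [c].
  by move=> /nonneg_comb_filter [cP _]; apply/coneE => //; exists c.
split=> [|_ /fan_ofP [Q' [S [QQQ' ->]]] sub]; first exact: fan_of_cone.
have uQ := free_uniq (QQ_free QQQ); have uQ' := free_uniq (QQ_free QQQ').
have uS : uniq (seq.filter S Q') by rewrite filter_uniq.
have comp : compatible Q (seq.filter S Q').
  by rewrite -[Q]filter_predT; apply: compatible_filter; exact: QQ_compat.
have subQ := compatible_cone_sub uQ uS comp sub.
apply: cone_perm => //; apply: uniq_perm => //.
have sz : (size (seq.filter S Q') <= size Q)%N.
  by rewrite (QQk _ QQQ) -(QQk _ QQQ') size_filter count_size.
have [_ h] := uniq_min_size uQ subQ sz => v; rewrite -h //.
Qed.

End FanOf.
End Cones.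

(** * Lattices *)

Section Lattices.
Variables (R : realType) (n : nat).
Local Notation V := 'rV[R]_n.
Implicit Types (A L M : set V) (B Q : seq V) (x v w : V) (u : 'cV[R]_n).

Definition subgroup_set L : Prop :=
  L 0 /\ forall x y, L x -> L y -> L (x - y).

Section Subgroup.
Variables (L : set V) (Lsub : subgroup_set L).

Lemma subgroup_setN x : L x -> L (- x).
Proof. by move=> Lx; rewrite -[- x]add0r; apply: Lsub.2 => //; exact: Lsub.1. Qed.

Lemma subgroup_setD x y : L x -> L y -> L (x + y).
Proof.
by move=> Lx Ly; rewrite -[y]opprK; apply: Lsub.2 => //; exact: subgroup_setN.
Qed.

Lemma subgroup_setMn x k : L x -> L (x *+ k).
Proof.
move=> Lx; elim: k => [|k IH]; first by rewrite mulr0n; exact: Lsub.1.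
by rewrite mulrS; exact: subgroup_setD.
Qed.

Lemma subgroup_setMz x (z : int) : L x -> L (x *~ z).
Proof.
move=> Lx; case: z => k; first exact: subgroup_setMn.
by rewrite NegzE mulrNz; apply: subgroup_setN; exact: subgroup_setMn.
Qed.

Lemma Zspan_min A : A `<=` L -> Zspan A `<=` L.
Proof.
move=> AL _ [m [z [v [Av ->]]]]; apply: (big_ind L); first exact: Lsub.1.
- exact: subgroup_setD.
- by move=> i _; apply: subgroup_setMz; exact: AL.
Qed.

End Subgroup.

Lemma Zspan_subgroup A : subgroup_set (Zspan A).
Proof.
split; first by exists 0%N, (fun=> 0), (fun=> 0); split=> [[]//|]; rewrite big_ord0.
move=> _ _ [m [z [v [Av ->]]]] [m' [z' [v' [Av' ->]]]].
exists (m + m')%N.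
exists (fun i => match fintype.split i with inl j => z j | inr j => - z' j end).
exists (fun i => match fintype.split i with inl j => v j | inr j => v' j end).
split=> [i|]; first by case: (fintype.split i).
rewrite big_split_ord /= -sumrN; congr (_ + _); apply: eq_bigr => i _.
  by rewrite (unsplitK (inl i)).
by rewrite (unsplitK (inr i)) mulrNz.
Qed.

Lemma sub_Zspan A : A `<=` Zspan A.
Proof.
move=> x Ax; exists 1%N, (fun=> 1), (fun=> x).
by rewrite big_ord_recl big_ord0 addr0 mulr1z.
Qed.

Lemma mem_Zspan B v : v \in B -> Zspan [set` B] v.
Proof. by move=> vB; apply: sub_Zspan. Qed.

Lemma Zspan_sub_span B x : Zspan [set` B] x -> x \in <<B>>%VS.
Proof.
apply: (Zspan_min (L := [set x | x \in <<B>>%VS])) => [|v vB] /=.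
  by split=> [|a b]; [exact: mem0v|exact: memvB].
exact: memv_span.
Qed.

Lemma Zspan_pairing_int B u x : (forall v, v \in B -> pairing u v \is a Num.int) ->
  Zspan [set` B] x -> pairing u x \is a Num.int.
Proof.
move=> Bint; apply: (Zspan_min (L := [set x | pairing u x \is a Num.int])) => //=.
split=> [|a b /= ai bi] /=; first by rewrite linear0 rpred0.
by rewrite linearB rpredB.
Qed.

Lemma free_exchange B B' : free B -> size B' = size B ->
  {subset B <= <<B'>>%VS} -> free B'.
Proof.
move=> freeB sz sub; rewrite /free eqn_leq dim_span sz -{1}(eqP freeB).
by apply/dimvS/span_subvP.
Qed.

Lemma Zbasis_exchange M B B' : Zbasis M B -> size B' = size B ->
  (forall v, v \in B' -> M v) -> (forall v, v \in B -> Zspan [set` B'] v) ->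
  Zbasis M B'.
Proof.
move=> [freeB ->] sz B'M BB'; split.
  by apply: (free_exchange freeB) => // v /BB' /Zspan_sub_span.
by apply/seteqP; split; apply: Zspan_min => //; exact: Zspan_subgroup.
Qed.

Lemma Zbasis_subgroup M B : Zbasis M B -> subgroup_set M.
Proof. by case=> _ ->; exact: Zspan_subgroup. Qed.

Lemma Zbasis_mem M B v : Zbasis M B -> v \in B -> M v.
Proof. by case=> _ -> /mem_Zspan. Qed.

Lemma Zbasis_coord M B w : Zbasis M B -> w \in B ->
  exists u, [/\ forall v, v \in B -> pairing u v = (v == w)%:R,
    forall c, pairing u (\sum_(v <- B) c v *: v) = c w
  & forall x, M x -> pairing u x \is a Num.int].
Proof.
move=> [freeB ->] wB; have [u uP u_sum] := coef_functional freeB wB.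
exists u; split=> // x.
by apply: Zspan_pairing_int => v vB; rewrite uP // rpred_nat.
Qed.

Lemma pairing_age x : pairing (const_mx 1) x = age x.
Proof. by rewrite /pairing mxE; apply: eq_bigr => j _; rewrite mxE mulr1. Qed.

Lemma age_sum B (c : V -> R) : (forall v, v \in B -> age v = 1) ->
  age (\sum_(v <- B) c v *: v) = \sum_(v <- B) c v.
Proof.
move=> B1; rewrite -pairing_age linear_sum big_seq [RHS]big_seq /=.
by apply: eq_bigr => v vB; rewrite linearZ /= pairing_age B1 // mulr1.
Qed.

(** If [P = Q *+ k], the integer [age Q] times [k] is 1. *)
Lemma age_primitive M P : (forall x, M x -> age x \is a Num.int) ->
  M P -> age P = 1 -> Defs.primitive M P.
Proof.
move=> Mint MP P1; split=> // [P0|Q k MQ PE].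
  by move/eqP: P1; rewrite -pairing_age P0 linear0 eq_sym oner_eq0.
have /intrP [z zE] := Mint _ MQ.
move: P1; rewrite PE -pairing_age raddfMn /= pairing_age zE -mulr_natr => zk.
have /eqP : (z * k%:Z)%:~R = 1%:~R :> R by rewrite intrM.
rewrite eqr_int => /eqP /(congr1 absz); rewrite abszM => /eqP.
by rewrite muln_eq1 => /andP[_ /eqP].
Qed.

End Lattices.

(** * Crepant refinements *)

Section Gluing.
Variables (R : realType) (n : nat).
Local Notation V := 'rV[R]_n.
Implicit Types (M X : set V) (Q T : seq V) (x v w t : V) (u : 'cV[R]_n)
  (c : V -> R).

Definition crepant_basis M Q : Prop :=
  [/\ size Q = 3%N, Zbasis M Q & forall v, v \in Q -> age v = 1].

Lemma nonneg_comb_trans Q T c (d : V -> V -> R) x :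
  (forall v, v \in T -> nonneg_comb Q (d v) v) -> nonneg_comb T c x ->
  nonneg_comb Q (fun w => \sum_(v <- T) c v * d v w) x.
Proof.
move=> dP [c0 cN ->]; split=> [w|w wQ|].
- rewrite big_seq; apply: sumr_ge0 => v vT.
  by case: (dP v vT) => d0 _ _; rewrite mulr_ge0.
- rewrite big_seq big1 // => v vT.
  by case: (dP v vT) => _ dN _; rewrite dN ?mulr0.
under [RHS]eq_bigr do rewrite scaler_suml.
rewrite exchange_big /= big_seq [RHS]big_seq; apply: eq_bigr => v vT.
case: (dP v vT) => _ _ vE; rewrite [X in _ *: X = _]vE scaler_sumr.
by apply: eq_bigr => w _; rewrite scalerA.
Qed.

(** If [x] lies in both refined cones, each generator [t] that it uses lies on the common face of
    [Q] and [Q']. Expanded over [Q] and over [Q'], [x] has the same coefficients, zero off [Q'];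
    they are sums of nonnegative terms, so the contribution of [t] vanishes there too. *)
Lemma refinement_support Q Q' T T' c c' x t : uniq Q -> uniq Q' ->
  compatible Q Q' ->
  (forall v, v \in T -> cone Q v) -> (forall v, v \in T' -> cone Q' v) ->
  nonneg_comb T c x -> nonneg_comb T' c' x -> 0 < c t ->
  exists2 d, nonneg_comb Q d t & forall v, v \notin Q' -> d v = 0.
Proof.
move=> uQ uQ' QQ' TQ TQ' cP cP' ct.
have ex_d Q0 T0 : uniq Q0 -> (forall v, v \in T0 -> cone Q0 v) ->
    exists d : V -> V -> R, forall v, v \in T0 -> nonneg_comb Q0 (d v) v.
  move=> uQ0 T0Q.
  have /choice [d dP] v : exists d : V -> R, v \in T0 -> nonneg_comb Q0 d v.
    case: (boolP (v \in T0)) => [/T0Q /(coneE _ uQ0) [d dP]|_]; first by exists d.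
    by exists (fun=> 0).
  by exists d.
have [d dP] := ex_d _ _ uQ TQ; have [d' dP'] := ex_d _ _ uQ' TQ'.
have tT : t \in T.
  by case: cP => _ cN _; apply: contraLR ct => /cN ->; rewrite ltxx.
exists (d t); first exact: dP.
move=> w wQ'.
have := QQ' _ _ _ (nonneg_comb_trans dP cP) (nonneg_comb_trans dP' cP') w.
have [_ -> //] := nonneg_comb_trans dP' cP'.
have [c0 _ _] := cP.
move=> _ /eqP; rewrite big_seq psumr_eq0 => [/allP/(_ t tT)|v vT]; last first.
  by case: (dP v vT) => d0 _ _; rewrite mulr_ge0.
by rewrite tT mulf_eq0 gt_eqF //= => /eqP.
Qed.

Lemma nonneg_comb_eq_of_support T T' c c' x : free T -> uniq T' ->
  nonneg_comb T c x -> nonneg_comb T' c' x ->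
  (forall v, 0 < c' v -> v \in T) -> c =1 c'.
Proof.
move=> freeT uT' cP cP' c'T; apply: (nonneg_comb_inj freeT cP).
apply: (nonneg_comb_transfer uT' (free_uniq freeT) cP') => v vT.
have [c'0 _ _] := cP'; apply/eqP; rewrite eq_le c'0 andbT leNgt.
by apply: contra vT => /c'T.
Qed.

Lemma nonneg_comb_age Q c x : (forall v, v \in Q -> age v = 1) ->
  nonneg_comb Q c x -> age x = \sum_(v <- Q) c v.
Proof. by move=> Q1 [_ _ ->]; rewrite age_sum. Qed.

(* The segment between t1 and t2 contains no further lattice point, so a point
   v beyond t1 would be the end of a segment [v, w] having t1 in its interior. *)
Lemma lattice_line_ge0 M T T' c c' x t1 t2 : Zbasis M T -> Zbasis M T' ->
  nonneg_comb T c x -> nonneg_comb T' c' x ->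
  t1 \in T -> t2 \in T -> t1 != t2 -> 0 < c t2 ->
  (forall w, 0 < c' w -> exists b, w = (1 - b) *: t1 + b *: t2) ->
  forall v b, 0 < c' v -> v = (1 - b) *: t1 + b *: t2 ->
    0 <= b /\ b \is a Num.int.
Proof.
move=> bT bT' [c0 cN xE] [c'0 c'N xE'] t1T t2T t12 ct2 line v b c'v vE.
have suppT' w : 0 < c' w -> w \in T'.
  by apply: contraTT => /c'N ->; rewrite ltxx.
have [u [uT u_sum u_int]] := Zbasis_coord bT t2T.
have uE w b' : w = (1 - b') *: t1 + b' *: t2 -> pairing u w = b'.
  move=> ->; rewrite linearD !linearZ /= !uT // eqxx (negPf t12).
  by rewrite mulr0 add0r mulr1.
(* The parameter [b] is the [t2]-coordinate of the lattice vector [v] in the basis [T]. *)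
have b_int : b \is a Num.int.
  by rewrite -(uE v b) //; apply: u_int; apply: (Zbasis_mem bT'); exact: suppT'.
split=> //; rewrite leNgt; apply/negP => b_lt0.
(* The [t2]-coordinate of [x] is positive, so it cannot be nonpositive on the whole [T']-support of
   [x]. *)
have [w c'w uw] : exists2 w, 0 < c' w & 0 < pairing u w.
  apply: contrapT => no_w.
  have : pairing u x <= 0.
    rewrite xE' linear_sum /=; apply: sumr_le0 => w _; rewrite linearZ /=.
    have := c'0 w; rewrite le_eqVlt => /predU1P [<-|c'w]; first by rewrite mul0r.
    rewrite pmulr_rle0 // leNgt; apply/negP => uw.
    by apply: no_w; exists w.
  by rewrite xE u_sum leNgt ct2.
have [g wE] := line w c'w.
rewrite (uE w g) // in uw.
have gb : 0 < g - b by lra.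
have vw : v != w.
  by apply/eqP => vw; have := uE v b vE; rewrite vw (uE w g) //; lra.
have [u' [u'T _ u'_int]] := Zbasis_coord bT' (suppT' v c'v).
(* With [b < 0 < g], the vector [t1] lies strictly between [v] and [w]. Its [v]-coordinate in the
   basis [T'] would be [g / (g - b)], an integer strictly between 0 and 1. *)
have t1E : t1 = (g - b)^-1 *: (g *: v - b *: w).
  rewrite vE wE; apply/rowP => j; rewrite !mxE; field; exact: lt0r_neq0.
have := u'_int t1 (Zbasis_mem bT t1T).
rewrite {1}t1E linearZ /= linearB /= !linearZ /= !u'T ?suppT' // eqxx eq_sym (negPf vw).
rewrite mulr1 mulr0n oppr0 scaler0 addr0 => /intrP [z zE].
have : 0 < (z%:~R : R) by rewrite -zE mulr_gt0 ?invr_gt0.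
have : (z%:~R : R) < 1 by rewrite -zE mulrC ltr_pdivrMr // mul1r ltrDl oppr_gt0.
by rewrite -[1]/(1%:~R) ltrz1 ltr0z; lia.
Qed.

(** Writing a support vector as [(1 - b) *: t1 + b *: t2], the previous lemma applied from either
    end makes both [b] and [1 - b] nonnegative, with [b] an integer. So the vector is [t1] or
    [t2]. *)
Lemma line_support_sub M T T' c c' x A B : Zbasis M T -> Zbasis M T' ->
  nonneg_comb T c x -> nonneg_comb T' c' x ->
  (forall t, 0 < c t -> exists a, t = (1 - a) *: A + a *: B) ->
  (forall t, 0 < c' t -> exists a, t = (1 - a) *: A + a *: B) ->
  (exists t1 t2, [/\ 0 < c t1, 0 < c t2 & t1 != t2]) ->
  forall v, 0 < c' v -> v \in T.
Proof.
move=> bT bT' cP cP' lineT lineT' [t1 [t2 [ct1 ct2 t12]]] v c'v.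
have suppT w : 0 < c w -> w \in T.
  by case: cP => _ cN _; apply: contraTT => /cN ->; rewrite ltxx.
have [[a1 t1E] [a2 t2E]] := (lineT _ ct1, lineT _ ct2).
have a12 : a2 - a1 != 0.
  by rewrite subr_eq0; apply: contra t12 => /eqP a12; rewrite t1E t2E a12.
have line w : 0 < c' w -> exists b, w = (1 - b) *: t1 + b *: t2.
  move=> /lineT' [a ->]; exists ((a - a1) / (a2 - a1)).
  by rewrite t1E t2E; apply/rowP => j; rewrite !mxE; field.
have line' w : 0 < c' w -> exists b, w = (1 - b) *: t2 + b *: t1.
  by move=> /line [b ->]; exists (1 - b); rewrite subKr addrC.
have [b vE] := line v c'v.
have vE' : v = (1 - (1 - b)) *: t2 + (1 - b) *: t1.
  by rewrite vE subKr addrC.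
have [b0 b_int] := lattice_line_ge0 bT bT' cP cP' (suppT _ ct1) (suppT _ ct2)
  t12 ct2 line c'v vE.
rewrite eq_sym in t12.
have [b1 _] := lattice_line_ge0 bT bT' cP cP' (suppT _ ct2) (suppT _ ct1)
  t12 ct1 line' c'v vE'.
have /intrP [z zE] := b_int.
have : (0 <= z)%R by rewrite -(ler0z R) -zE.
have : (z <= 1)%R by rewrite -(lerz1 R) -zE -subr_ge0.
case: z zE => [[|[|k]]|k] //= zE _ _; rewrite vE zE.
  by rewrite subr0 scale1r scale0r addr0 suppT.
by rewrite subrr scale0r add0r scale1r suppT.
Qed.

Lemma nonneg_comb_single Q c x t : t \in Q -> uniq Q -> nonneg_comb Q c x ->
  (forall v, 0 < c v -> v = t) -> x = c t *: t.
Proof.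
move=> tQ uQ [c0 _ ->] ct; rewrite (bigD1_seq t) //= big1 ?addr0 // => v vt.
have := c0 v; rewrite le_eqVlt => /predU1P [<-|/ct vE]; first by rewrite scale0r.
by rewrite vE eqxx in vt.
Qed.

(* Q and Q' share at most an edge, and T and T' both subdivide it at all of its
   lattice points of age one. *)
Lemma crepant_refinements_compatible M Q Q' T T' w :
  size Q = 3%N -> free Q -> (forall v, v \in Q -> age v = 1) -> uniq Q' ->
  compatible Q Q' -> w \in Q -> w \notin Q' ->
  crepant_basis M T -> crepant_basis M T' ->
  (forall v, v \in T -> cone Q v) -> (forall v, v \in T' -> cone Q' v) ->
  compatible T T'.
Proof.
move=> szQ freeQ ageQ uQ' QQ' wQ wQ' [_ bT ageT] [_ bT' ageT'] TQ TQ' c c' x cP cP'.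
have uQ := free_uniq freeQ; have freeT := bT.1; have freeT' := bT'.1.
have uT := free_uniq freeT; have uT' := free_uniq freeT'.
have suppT v : 0 < c v -> v \in T.
  by case: cP => _ cN _; apply: contraTT => /cN ->; rewrite ltxx.
have suppT' v : 0 < c' v -> v \in T'.
  by case: cP' => _ cN _; apply: contraTT => /cN ->; rewrite ltxx.
have [A [B Qperm]] : exists A B, perm_eq Q [:: w; A; B].
  have := perm_to_rem wQ; have := size_rem wQ; rewrite szQ.
  by case: (rem w Q) => [|A [|B []]] // _ p; exists A, B.
(* Since [w] is not in [Q'], the common face lies in the cone on [A] and [B]; the vectors of age one
   in that cone form the segment from [A] to [B]. *)
have edge t d : age t = 1 -> nonneg_comb Q d t -> d w = 0 ->
    exists a, t = (1 - a) *: A + a *: B.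
  move=> t1 dP dw; exists (d B).
  have := nonneg_comb_age ageQ dP; have [_ _ tE] := dP.
  rewrite t1 tE !(perm_big _ Qperm) !big_cons !big_nil dw /= scale0r !add0r !addr0.
  by move=> ->; rewrite addrK.
have lineT t : 0 < c t -> exists a, t = (1 - a) *: A + a *: B.
  move=> ct; have [d dP dN] := refinement_support uQ uQ' QQ' TQ TQ' cP cP' ct.
  by apply: (edge t d); rewrite ?ageT ?suppT ?dN.
have lineT' t : 0 < c' t -> exists a, t = (1 - a) *: A + a *: B.
  move=> ct; have QQ's := compatible_sym QQ'.
  have [d dP dN] := refinement_support uQ' uQ QQ's TQ' TQ cP' cP ct.
  apply: (edge t d); rewrite ?ageT' ?suppT' //.
    exact: nonneg_comb_transfer dP dN.
  by case: dP => _ ->.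
have [two|one] := pselect (exists t1 t2, [/\ 0 < c t1, 0 < c t2 & t1 != t2]).
  apply: (nonneg_comb_eq_of_support freeT uT' cP cP').
  exact: (line_support_sub bT bT' cP cP' lineT lineT' two).
have [two'|one'] := pselect (exists t1 t2, [/\ 0 < c' t1, 0 < c' t2 & t1 != t2]).
  apply: fsym; apply: (nonneg_comb_eq_of_support freeT' uT cP' cP).
  exact: (line_support_sub bT' bT cP' cP lineT' lineT two').
(* Both supports now have at most one vector. If [t'] is one, then [x] is a positive multiple of
   [t'] and of a single [t] in [T]; both scalars equal [age x], whence [t = t']. *)
apply: (nonneg_comb_eq_of_support freeT uT' cP cP') => t' c't'.
have xE' : x = c' t' *: t'.
  apply: (nonneg_comb_single (suppT' _ c't') uT' cP') => v c'v.
  by apply/eqP; apply: contrapT => /negP vt'; apply: one'; exists v, t'.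
have agex : age x = c' t'.
  by rewrite xE' -pairing_age linearZ /= pairing_age ageT' ?mulr1 ?suppT'.
have [t ct] : exists t, 0 < c t.
  apply: contrapT => no_t; have := nonneg_comb_age ageT cP.
  rewrite big1 => [|v _]; first by rewrite agex => c'0; rewrite c'0 ltxx in c't'.
  case: cP => c0 _ _; apply/eqP; rewrite eq_le c0 andbT leNgt; apply/negP => cv.
  by apply: no_t; exists v.
have xE : x = c t *: t.
  apply: (nonneg_comb_single (suppT _ ct) uT cP) => v cv.
  by apply/eqP; apply: contrapT => /negP vt; apply: one; exists v, t.
have agex' : age x = c t.
  by rewrite xE -pairing_age linearZ /= pairing_age ageT ?mulr1 ?suppT.
have : c' t' *: t' = c' t' *: t by rewrite -xE' xE -agex' -agex.
by move/(scalerI (lt0r_neq0 c't')) => ->; exact: suppT.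
Qed.

(** The invariant carried along the chain. [X] is arbitrary so that the same notion serves for the
    orthant and for a single cone being subdivided. *)
Definition triangulation M (QQ : set (seq V)) X : Prop :=
  [/\ finite_set QQ,
      forall Q, QQ Q -> crepant_basis M Q /\ cone Q `<=` X,
      forall Q Q', QQ Q -> QQ Q' -> compatible Q Q'
    & forall x, X x -> exists2 Q, QQ Q & cone Q x].

(** Glues triangulations of the pieces [q i], which need age one and freeness but not unimodularity
    with respect to [M]. It serves both for the star subdivision of one cone and for assembling all
    maximal cones in a step. *)
Lemma triangulation_bigcup (I : Type) (J : set I) M (q : I -> seq V)
    (QQ : I -> set (seq V)) X :
  finite_set J ->
  (forall i, J i -> [/\ size (q i) = 3%N, free (q i),
     forall v, v \in q i -> age v = 1 & cone (q i) `<=` X]) ->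
  (forall i j, J i -> J j -> compatible (q i) (q j)) ->
  (forall i j, J i -> J j -> i <> j -> exists2 v, v \in q i & v \notin q j) ->
  (forall x, X x -> exists2 i, J i & cone (q i) x) ->
  (forall i, J i -> triangulation M (QQ i) (cone (q i))) ->
  triangulation M (\bigcup_(i in J) QQ i) X.
Proof.
move=> finJ qP qq q_neq qX triQ; split.
- by apply: bigcup_finite => // i /triQ [].
- move=> Q [i Ji QQi]; have [_ /(_ Q QQi) [? Qi] _ _] := triQ i Ji.
  by split=> //; apply: subset_trans Qi _; have [] := qP i Ji.
- move=> Q Q' [i Ji QQi] [j Jj QQj].
  have [_ /(_ Q QQi) [cQ Qi] compi _] := triQ i Ji.
  have [_ /(_ Q' QQj) [cQ' Qj] _ _] := triQ j Jj.
  have [ij|ij] := pselect (i = j); first by apply: compi => //; rewrite ij.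
  have [w wi wj] := q_neq i j Ji Jj ij.
  have [szi freei agei _] := qP i Ji; have [_ freej _ _] := qP j Jj.
  apply: (crepant_refinements_compatible szi freei agei (free_uniq freej) _
    wi wj cQ cQ') => [|v vQ|v vQ]; first exact: qq.
    by apply: Qi; apply: mem_cone => //; case: cQ => _ [/free_uniq].
  by apply: Qj; apply: mem_cone => //; case: cQ' => _ [/free_uniq].
- move=> x /qX [i Ji xi]; have [_ _ _ /(_ x xi) [Q QQi Qx]] := triQ i Ji.
  by exists Q => //; exists i.
Qed.

End Gluing.

(** * Fujiki-Oka subdivisions *)

Section Triples.
Variables (R : realType) (n : nat).
Local Notation V := 'rV[R]_n.
Implicit Types (M X : set V) (A B C E P v w x : V).

Lemma free3_eq A B C (a b c a' b' c' : R) : free [:: A; B; C] ->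
  a *: A + b *: B + c *: C = a' *: A + b' *: B + c' *: C ->
  [/\ a = a', b = b' & c = c'].
Proof.
move=> freeT eqT.
have /freeP k0 : free (in_tuple [:: A; B; C]) by [].
have := k0 (fun i => [:: a - a'; b - b'; c - c']`_i).
rewrite !big_ord_recl big_ord0 /= addr0 addrA !scalerBl.
have -> : a *: A - a' *: A + (b *: B - b' *: B) + (c *: C - c' *: C) = 0.
  move/eqP: eqT; rewrite -subr_eq0 => /eqP <-.
  by apply/rowP => j; rewrite !mxE; ring.
move=> /(_ erefl) kk0.
have := kk0 ord0; have := kk0 (lift ord0 ord0).
have := kk0 (lift ord0 (lift ord0 ord0)); rewrite /=.
by split; apply/eqP; rewrite -subr_eq0; apply/eqP.
Qed.

Lemma cone3P A B C x : cone [:: A; B; C] x <->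
  exists a b c : R, [/\ 0 <= a, 0 <= b, 0 <= c & x = a *: A + b *: B + c *: C].
Proof.
split=> [[c [c0 ->]]|[a [b [c [a0 b0 c0 ->]]]]].
  exists (c ord0), (c (lift ord0 ord0)), (c (lift ord0 (lift ord0 ord0))).
  by split=> //; rewrite !big_ord_recl big_ord0 addr0 addrA.
exists (fun i => [:: a; b; c]`_i); split.
  by case=> [[|[|[|]]]].
by rewrite !big_ord_recl big_ord0 addr0 addrA.
Qed.

Lemma Zspan3P A B C x : Zspan [set` [:: A; B; C]] x <->
  exists a b c : int, x = a%:~R *: A + b%:~R *: B + c%:~R *: C.
Proof.
split; last first.
  have sub := Zspan_subgroup [set` [:: A; B; C]].
  move=> [a [b [c ->]]]; rewrite !scaler_int.
  by do 2?[apply: subgroup_setD => //]; apply: subgroup_setMz => //;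
    apply: mem_Zspan; rewrite !inE eqxx ?orbT.
apply: (Zspan_min (L := [set x | exists a b c : int, x = _])).
  split=> /=; first by exists 0, 0, 0; rewrite !scale0r !addr0.
  move=> _ _ [a [b [c ->]]] [a' [b' [c' ->]]]; exists (a - a'), (b - b'), (c - c').
  by apply/rowP => j; rewrite !mxE; ring.
move=> v /=; rewrite !inE => /or3P[]/eqP ->.
- by exists 1, 0, 0; rewrite scale1r !scale0r !addr0.
- by exists 0, 1, 0; rewrite scale1r !scale0r add0r addr0.
- by exists 0, 0, 1; rewrite scale1r !scale0r !add0r.
Qed.

Lemma has_index_le M L s s' : subgroup_set L ->
  has_index M L s -> has_index M L s' -> (s <= s')%N.
Proof.
move=> Lsub [t [Mt tP]] [t' [Mt' t'P]].
have /choice [f fP] i : exists j, L (t i - t' j).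
  by have [j [Lj _]] := t'P _ (Mt i); exists j.
have f_inj : injective f.
  move=> i k fik; have [j [_ j_uniq]] := tP _ (Mt i).
  have Lik : L (t i - t k).
    have -> : t i - t k = (t i - t' (f k)) - (t k - t' (f k)).
      by rewrite opprB addrA subrK.
    by apply: Lsub.2 => //; rewrite -fik.
  rewrite -(j_uniq k Lik); apply/esym; apply: j_uniq.
  by rewrite subrr; exact: Lsub.1.
by have := leq_card f f_inj; rewrite !card_ord.
Qed.

(** In [oka_center] the index is given only by a relation; uniqueness identifies it with the [s] of
    a known semi-unimodular presentation. *)
Lemma has_index_uniq M L s s' : subgroup_set L ->
  has_index M L s -> has_index M L s' -> s = s'.
Proof.
by move=> Lsub h h'; apply/eqP; rewrite eqn_leq !(@has_index_le M L).
Qed.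

(* E completes P2, P3 to a basis of M, and s is the index of the cone. *)
Definition semi_unimodular_by M P1 P2 P3 (s : nat) E (m2 m3 : int) : Prop :=
  [/\ (0 < s)%N, Zbasis M [:: E; P2; P3]
    & P1 = s%:R *: E + m2%:~R *: P2 + m3%:~R *: P3].

Section SemiUnimodular.
Variables (M : set V) (P1 P2 P3 E : V) (s : nat) (m2 m3 : int).
Hypothesis semiP : semi_unimodular_by M P1 P2 P3 s E m2 m3.

Let s_gt0 : (0 < s)%N. Proof. by case: semiP. Qed.
Let basisE : Zbasis M [:: E; P2; P3]. Proof. by case: semiP. Qed.
Let P1E : P1 = s%:R *: E + m2%:~R *: P2 + m3%:~R *: P3. Proof. by case: semiP. Qed.
Let sR_neq0 : s%:R != 0 :> R. Proof. by rewrite pnatr_eq0 -lt0n. Qed.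

Lemma semi_unimodular_mem v : v \in [:: P1; P2; P3] -> M v.
Proof.
rewrite inE => /predU1P [->|vP]; last first.
  by apply: (Zbasis_mem basisE); rewrite inE vP orbT.
case: basisE => _ ->; apply/Zspan3P; exists s%:Z, m2, m3.
by rewrite P1E -pmulrn.
Qed.

Lemma semi_unimodular_free : free [:: P1; P2; P3].
Proof.
have [freeE _] := basisE; apply: (free_exchange freeE) => // v.
have P1s : P1 \in <<[:: P1; P2; P3]>>%VS by apply: memv_span; rewrite inE eqxx.
have P2s : P2 \in <<[:: P1; P2; P3]>>%VS.
  by apply: memv_span; rewrite !inE eqxx orbT.
have P3s : P3 \in <<[:: P1; P2; P3]>>%VS.
  by apply: memv_span; rewrite !inE eqxx !orbT.
rewrite !inE => /or3P[]/eqP -> //.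
have -> : E = s%:R^-1 *: (P1 - m2%:~R *: P2 - m3%:~R *: P3).
  by rewrite P1E; apply/rowP => j; rewrite !mxE; field.
by rewrite memvZ // !memvB // memvZ.
Qed.

(** Modulo [P2] and [P3], the generator [P1] is [s] times [E]. So the multiples of [E] by 0, ...,
    [s - 1] represent the cosets, and the representative is found by dividing the [E]-coordinate by
    [s]. *)
Lemma semi_unimodular_index : cone_index M P1 [:: P2; P3] s.
Proof.
have Msub := Zbasis_subgroup basisE.
have EM : M E by apply: (Zbasis_mem basisE); rewrite inE eqxx.
exists (fun i : 'I_s => i%:R *: E); split=> [i|x Mx].
  by rewrite scaler_nat; apply: subgroup_setMn.
have [_ Meq] := basisE; move: Mx; rewrite Meq => /Zspan3P [a [b [c ->]]].
have sZ_neq0 : s%:Z != 0 by lia.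
have [r [rs rE]] : exists r : nat, (r < s)%N /\ r%:Z = (a %% s%:Z)%Z.
  exists `|(a %% s%:Z)%Z|%N; split.
    by have := ltz_pmod a (d := s%:Z); have := modz_ge0 a sZ_neq0; lia.
  by have := modz_ge0 a sZ_neq0; lia.
pose q := (a %/ s%:Z)%Z.
have aE : a = q * s%:Z + r%:Z by rewrite rE; exact: divz_eq.
exists (Ordinal rs); split=> [|i Li].
  apply/Zspan3P; exists q, (b - q * m2), (c - q * m3).
  by rewrite P1E aE /=; apply/rowP => j; rewrite !mxE; ring.
have [freeE _] := basisE.
have /Zspan3P [a' [b' [c' eqx]]] := Li; rewrite P1E in eqx.
have [aE' _ _] : [/\ a%:~R - i%:R = a'%:~R * s%:R :> R,
    b%:~R = a'%:~R * m2%:~R + b'%:~R :> R &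
    c%:~R = a'%:~R * m3%:~R + c'%:~R :> R].
  apply: (free3_eq freeE); transitivity
    (a%:~R *: E + b%:~R *: P2 + c%:~R *: P3 - i%:R *: E).
    by apply/rowP => j; rewrite !mxE; ring.
  by rewrite eqx; apply/rowP => j; rewrite !mxE; ring.
have {}aE' : a = a' * s%:Z + i%:Z.
  apply/eqP; rewrite -(eqr_int R) intrD intrM -!pmulrn -aE'; apply/eqP; ring.
apply/val_inj => /=; have := ltn_ord i.
have : `|(q - a') * s%:Z| = `|i%:Z - r%:Z| by congr `|_|; rewrite aE in aE'; lia.
rewrite normrM; case: (q - a') => [[|k]|k] /=; last 2 first.
- by nia.
- by nia.
by lia.
Qed.

Hypothesis M_age : forall x, M x -> age x \is a Num.int.
Hypothesis age1 : forall v, v \in [:: P1; P2; P3] -> age v = 1.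
Hypothesis s_gt1 : (1 < s)%N.

Lemma oka_center_exists : exists b C, oka_center M P1 [:: P2; P3] s b C.
Proof.
have sZ_neq0 : s%:Z != 0 by lia.
(* These residues cancel [m2] and [m3] modulo [s], so that [P1] plus the two corrections is [s]
   times a vector of the form [E] plus integral multiples of [P2] and [P3]. *)
pose b (i : nat) : nat := `|((if i is 0%N then - m2 else - m3) %% s%:Z)%Z|%N.
have bP m : exists q : int, q * s%:Z - m = `|((- m) %% s%:Z)%Z|%N%:Z /\
    (`|((- m) %% s%:Z)%Z|%N <= s - 1)%N.
  exists (- ((- m) %/ s%:Z)%Z); have := divz_eq (- m) s%:Z.
  have := modz_ge0 (- m) sZ_neq0; have := @ltz_pmod (- m) s%:Z.
  by set k := modz _ _; set q := divz _ _; split; lia.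
have [q2 [b2E b2_le]] := bP m2; have [q3 [b3E b3_le]] := bP m3.
exists b, (E + q2%:~R *: P2 + q3%:~R *: P3).
have CM : M (E + q2%:~R *: P2 + q3%:~R *: P3).
  by case: basisE => _ ->; apply/Zspan3P; exists 1, q2, q3; rewrite scale1r.
split=> //.
- by split=> //; exact: semi_unimodular_index.
- by case=> [|[|i]].
- rewrite !big_ord_recl big_ord0 addr0 /=.
  rewrite !pmulrn -b2E -b3E P1E.
  by apply/rowP => j; rewrite !mxE; field.
apply: (Zbasis_exchange basisE) => //= v; rewrite !inE => /or3P[]/eqP -> //.
- by apply: (Zbasis_mem basisE); rewrite !inE eqxx orbT.
- by apply: (Zbasis_mem basisE); rewrite !inE eqxx !orbT.
- apply/Zspan3P; exists 1, (- q2), (- q3).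
  by apply/rowP => j; rewrite !mxE; ring.
- by apply: mem_Zspan; rewrite !inE eqxx orbT.
- by apply: mem_Zspan; rewrite !inE eqxx !orbT.
Qed.

Lemma oka_centerE s' b C : oka_center M P1 [:: P2; P3] s' b C ->
  [/\ s' = s, (b 0%N < s)%N, (b 1%N < s)%N
    & C = s%:R^-1 *: (P1 + (b 0%N)%:R *: P2 + (b 1%N)%:R *: P3)].
Proof.
move=> [[idx _] b_le CE _ _].
have s'E : s' = s.
  by apply: has_index_uniq idx semi_unimodular_index; exact: Zspan_subgroup.
split=> //; first by have := b_le 0%N; rewrite s'E /=; lia.
  by have := b_le 1%N; rewrite s'E /=; lia.
by rewrite CE s'E !big_ord_recl big_ord0 addr0 /= addrA.
Qed.

(** The difference of two centers is a lattice vector with coordinates [(b i - b' i) / s] at [P2]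
    and [P3]; they are integers of absolute value below one. *)
Lemma oka_center_uniq s1 b C s2 b' C' :
  oka_center M P1 [:: P2; P3] s1 b C -> oka_center M P1 [:: P2; P3] s2 b' C' ->
  [/\ s1 = s2, b 0%N = b' 0%N, b 1%N = b' 1%N & C = C'].
Proof.
move=> oka oka'; have [-> b2s b3s CE] := oka_centerE oka.
have [-> b2s' b3s' CE'] := oka_centerE oka'.
have [_ _ _ CM _] := oka; have [_ _ _ CM' _] := oka'.
have := (Zbasis_subgroup basisE).2 _ _ CM CM'.
have [freeE Meq] := basisE; rewrite Meq => /Zspan3P [a [e [f]]].
have -> : C - C' = 0 *: E + (((b 0%N)%:R - (b' 0%N)%:R) / s%:R) *: P2 +
    (((b 1%N)%:R - (b' 1%N)%:R) / s%:R) *: P3.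
  by rewrite CE CE'; apply/rowP => j; rewrite !mxE; field.
move=> /(free3_eq freeE) [_ e2 e3].
have eqb (k k' : nat) (z : int) : (k < s)%N -> (k' < s)%N ->
    (k%:R - k'%:R) / s%:R = z%:~R :> R -> k = k'.
  move=> ks ks' /(congr1 (fun y => y * s%:R)); rewrite divfK // => kz.
  have {}kz : k%:Z - k'%:Z = z * s%:Z.
    by apply/eqP; rewrite -(eqr_int R) intrB intrM -!pmulrn kz.
  have : `|z * s%:Z| = `|k%:Z - k'%:Z| by rewrite kz.
  by rewrite normrM; case: z {kz} => [[|z]|z] /=; nia.
have b2E := eqb _ _ _ b2s b2s' e2; have b3E := eqb _ _ _ b3s b3s' e3.
by rewrite CE CE' b2E b3E.
Qed.

Lemma oka_center_age s' b C : oka_center M P1 [:: P2; P3] s' b C -> age C = 1.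
Proof.
move=> oka; have [_ b2s b3s CE] := oka_centerE oka; have [_ _ _ CM _] := oka.
have := M_age CM; have : age C = (1 + b 0%N + b 1%N)%:R / s%:R.
  rewrite CE -pairing_age !(linearZ, linearD) /= !pairing_age.
  by rewrite !age1 ?inE ?eqxx ?orbT // !natrD; field.
move=> ageE /intrP [z zE]; rewrite zE in ageE *.
have {}ageE : z * s%:Z = (1 + b 0%N + b 1%N)%:Z.
  by apply/eqP; rewrite -(eqr_int R) intrM -!pmulrn ageE divfK.
(* Both residues are at most [s - 1], so [z * s] lies between 1 and [2 * s - 1]. *)
have -> : z = 1 by nia.
by [].
Qed.

End SemiUnimodular.

(* -P2 completes C, P3 to a basis because P1 = s C - b2 P2 - b3 P3. *)
Lemma semi_unimodular_replace2 M P1 P2 P3 C (s b2 b3 : nat) :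
  (0 < s)%N -> (0 < b2)%N -> Zbasis M [:: C; P2; P3] ->
  C = s%:R^-1 *: (P1 + b2%:R *: P2 + b3%:R *: P3) ->
  semi_unimodular_by M P1 C P3 b2 (- P2) s%:Z (- b3%:Z).
Proof.
move=> s_gt0 b2_gt0 basisC CE.
have sR_neq0 : s%:R != 0 :> R by rewrite pnatr_eq0 -lt0n.
split=> //; last first.
  by rewrite CE; apply/rowP => j; rewrite !mxE; field.
have Msub := Zbasis_subgroup basisC.
apply: (Zbasis_exchange basisC) => //= v; rewrite !inE => /or3P[]/eqP -> //.
- apply: subgroup_setN => //.
  by apply: (Zbasis_mem basisC); rewrite !inE eqxx orbT.
- by apply: (Zbasis_mem basisC); rewrite !inE eqxx.
- by apply: (Zbasis_mem basisC); rewrite !inE eqxx !orbT.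
- by apply: mem_Zspan; rewrite !inE eqxx orbT.
- by apply/Zspan3P; exists (-1), 0, 0; rewrite !scale0r !addr0 scaleN1r opprK.
- by apply: mem_Zspan; rewrite !inE eqxx !orbT.
Qed.

Lemma Zbasis_perm M (B B' : seq V) : perm_eq B B' -> Zbasis M B -> Zbasis M B'.
Proof.
move=> p [freeB ->]; split; first by rewrite -(perm_free p).
by congr Zspan; apply/seteqP; split=> v /=; rewrite (perm_mem p).
Qed.

Lemma semi_unimodular_replace3 M P1 P2 P3 C (s b2 b3 : nat) :
  (0 < s)%N -> (0 < b3)%N -> Zbasis M [:: C; P2; P3] ->
  C = s%:R^-1 *: (P1 + b2%:R *: P2 + b3%:R *: P3) ->
  semi_unimodular_by M P1 P2 C b3 (- P3) (- b2%:Z) s%:Z.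
Proof.
move=> s_gt0 b3_gt0 basisC CE.
have [] // := @semi_unimodular_replace2 M P1 P3 P2 C s b3 b2 s_gt0 b3_gt0.
- by apply: Zbasis_perm basisC; rewrite perm_cons (perm_catC [:: P2] [:: P3]).
- by rewrite CE addrAC.
move=> _ basisC' P1E; split=> //; last by rewrite P1E addrAC.
by apply: Zbasis_perm basisC'; rewrite perm_cons (perm_catC [:: C] [:: P2]).
Qed.

End Triples.

Section FujikiOkaSubdivision.
Variables (R : realType) (n : nat).
Local Notation V := 'rV[R]_n.
Implicit Types (M X : set V) (C E P v w x : V) (c : V -> R).

(** One unfolding of the least fixpoint, in the form that lets the set of resulting cones be
    rewritten as a union over the star subdivision. *)
Lemma FO_coneE M P1 Ps Q : FO_cone M P1 Ps Q <->
  cone_index M P1 Ps 1 /\ Q = P1 :: Ps \/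
  exists s b C, oka_center M P1 Ps s b C /\
    (Q = C :: Ps \/ exists i, [/\ (i < size Ps)%N, b i <> 0%N &
       FO_cone M P1 (set_nth 0 Ps i C) Q]).
Proof.
split.
  case=> [Ps0 idx|Ps0 s b C oka|Ps0 s b C i Q0 oka ltPs bi FO]; first by left.
    by right; exists s, b, C; split=> //; left.
  by right; exists s, b, C; split=> //; right; exists i.
case=> [[idx ->]|[s [b [C [oka [->|[i [ltPs bi FO]]]]]]]].
- exact: FO_unchanged.
- exact: FO_smooth oka.
- exact: FO_replace oka ltPs bi FO.
Qed.

Lemma triangulation_set1 M Q : crepant_basis M Q ->
  triangulation M [set Q] (cone Q).
Proof.
move=> cQ; split=> [|_ ->|_ _ -> ->|x Qx] //; last by exists Q.
  by split.
have [_ [freeQ _] _] := cQ => c c' x; exact: nonneg_comb_inj.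
Qed.

Section StarSubdivision.
Variables (P1 P2 P3 C : V) (s b2 b3 : nat).
Hypothesis s_gt1 : (1 < s)%N.
Hypothesis freeP : free [:: P1; P2; P3].
Hypothesis CE : C = s%:R^-1 *: (P1 + b2%:R *: P2 + b3%:R *: P3).

Definition star_cone (k : nat) : seq V :=
  match k with 0 => [:: C; P2; P3] | 1 => [:: P1; C; P3] | _ => [:: P1; P2; C] end.

(** When [b2] or [b3] vanishes, [C] lies in the span of the two other generators and the
    corresponding cone degenerates, so its index is dropped. *)
Definition star_index : set nat :=
  [set k | [\/ k = 0, k = 1 /\ b2 <> 0 | k = 2 /\ b3 <> 0]]%N.

Let sR_gt0 : 0 < s%:R :> R. Proof. by rewrite ltr0n ltnW. Qed.

(** The [P1]-coordinate of [C] is [1 / s], strictly between 0 and 1. *)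
Lemma star_center_neq : [/\ P1 != C, P2 != C & P3 != C].
Proof.
have CE' : C = s%:R^-1 *: P1 + (b2%:R / s%:R) *: P2 + (b3%:R / s%:R) *: P3.
  by rewrite CE; apply/rowP => j; rewrite !mxE; field; exact: lt0r_neq0.
have eqC (a b c : R) : a *: P1 + b *: P2 + c *: P3 = C -> a = s%:R^-1.
  by rewrite CE' => /(free3_eq freeP) [].
have s1 : s%:R^-1 < 1 :> R by rewrite invf_lt1 // ltr1n.
have s0 : 0 < s%:R^-1 :> R by rewrite invr_gt0.
split; apply/eqP => eqP.
- have := eqC 1 0 0; rewrite scale1r !scale0r !addr0 => /(_ eqP); lra.
- have := eqC 0 1 0; rewrite scale1r !scale0r add0r addr0 => /(_ eqP); lra.
- have := eqC 0 0 1; rewrite scale1r !scale0r !add0r => /(_ eqP); lra.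
Qed.

Lemma star_generators_neq : [/\ P1 != P2, P1 != P3 & P2 != P3].
Proof.
by have := free_uniq freeP; rewrite /= !inE !negb_or !andbT => /andP[/andP[-> ->] ->].
Qed.

Lemma star_cone_neq i j : star_index i -> star_index j -> i <> j ->
  exists2 v, v \in star_cone i & v \notin star_cone j.
Proof.
have [h1 h2 h3] := star_center_neq; have [h12 h13 h23] := star_generators_neq.
case=> [->|[-> _]|[-> _]]; case=> [->|[-> _]|[-> _]] // _.
- by exists P2; rewrite !inE ?eqxx ?orbT // !negb_or eq_sym h12 h2 h23.
- by exists P3; rewrite !inE ?eqxx ?orbT // !negb_or eq_sym h13 eq_sym h23 h3.
- by exists P1; rewrite !inE ?eqxx ?orbT // !negb_or h1 h12 h13.
- by exists P3; rewrite !inE ?eqxx ?orbT // !negb_or eq_sym h13 eq_sym h23 h3.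
- by exists P1; rewrite !inE ?eqxx ?orbT // !negb_or h1 h12 h13.
- by exists P2; rewrite !inE ?eqxx ?orbT // !negb_or eq_sym h12 h2 h23.
Qed.

(** Gives the three star cones a common shape, four coefficients one of which vanishes, so that
    pairs of cones need not be compared case by case. *)
Lemma star_comb k c x : star_index k -> nonneg_comb (star_cone k) c x ->
  [/\ forall v, 0 <= c v, forall v, v \notin [:: C; P1; P2; P3] -> c v = 0,
      x = c C *: C + c P1 *: P1 + c P2 *: P2 + c P3 *: P3 &
      [\/ c P1 = 0, b2 <> 0%N /\ c P2 = 0 | b3 <> 0%N /\ c P3 = 0]].
Proof.
have [h1 h2 h3] := star_center_neq; have [h12 h13 h23] := star_generators_neq.
move=> kP [c0 cN xE].
have zero v : v \notin [:: C; P1; P2; P3] -> c v = 0.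
  move=> vN; apply: cN; move: vN; rewrite !inE !negb_or.
  by case: kP => [->|[-> _]|[-> _]]; rewrite /= !inE !negb_or => /and4P[*]; apply/and3P; split.
split=> //.
  case: kP cN xE => [->|[-> _]|[-> _]] cN ->; rewrite !big_cons big_nil.
  - have -> : c P1 = 0 by apply: cN; rewrite !inE !negb_or h1 h12 h13.
    by apply/rowP => j; rewrite !mxE; ring.
  - have -> : c P2 = 0.
      by apply: cN; rewrite !inE !negb_or eq_sym h12 h2 h23.
    by apply/rowP => j; rewrite !mxE; ring.
  - have -> : c P3 = 0.
      by apply: cN; rewrite !inE !negb_or eq_sym h13 eq_sym h23 h3.
    by apply/rowP => j; rewrite !mxE; ring.
case: kP cN => [->|[-> bb]|[-> bb]] cN.
- by constructor 1; apply: cN; rewrite !inE !negb_or h1 h12 h13.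
- by constructor 2; split=> //; apply: cN; rewrite !inE !negb_or eq_sym h12 h2 h23.
- constructor 3; split=> //; apply: cN.
  by rewrite !inE !negb_or eq_sym h13 eq_sym h23 h3.
Qed.

(** The coefficient of [C] is intrinsic: it is the largest [t] for which [x - t *: C] stays in the
    cone on [P1], [P2], [P3]. It is attained because some generator with nonzero coefficient in [C]
    is missing. The other coefficients follow by freeness. *)
Lemma star_compatible i j : star_index i -> star_index j ->
  compatible (star_cone i) (star_cone j).
Proof.
move=> iJ jJ c c' x /(star_comb iJ) [c0 cN xE cz] /(star_comb jJ) [c'0 c'N xE' c'z].
have coords (d : V -> R) : d C *: C + d P1 *: P1 + d P2 *: P2 + d P3 *: P3 =
    (d C / s%:R + d P1) *: P1 + (d C / s%:R * b2%:R + d P2) *: P2 +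
    (d C / s%:R * b3%:R + d P3) *: P3.
  by rewrite CE; apply/rowP => l; rewrite !mxE; field; exact: lt0r_neq0.
move: xE'; rewrite xE !coords => /(free3_eq freeP) [e1 e2 e3].
have pos b : b <> 0%N -> 0 < b%:R :> R by move=> ?; rewrite ltr0n; lia.
(* At the generator missing from [d], the coordinate of [x] comes from [C] alone, while [d'] may add
   a nonnegative amount to the share of [C]. *)
have leC (d d' : V -> R) : (forall v, 0 <= d' v) ->
    d C / s%:R + d P1 = d' C / s%:R + d' P1 ->
    d C / s%:R * b2%:R + d P2 = d' C / s%:R * b2%:R + d' P2 ->
    d C / s%:R * b3%:R + d P3 = d' C / s%:R * b3%:R + d' P3 ->
    [\/ d P1 = 0, b2 <> 0%N /\ d P2 = 0 | b3 <> 0%N /\ d P3 = 0] ->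
    d' C / s%:R <= d C / s%:R.
  move=> d'0 f1 f2 f3 [dz|[/pos bz dz]|[/pos bz dz]].
  - by have := d'0 P1; lra.
  - by rewrite -(ler_pM2r bz); have := d'0 P2; lra.
  - by rewrite -(ler_pM2r bz); have := d'0 P3; lra.
have cC : c C / s%:R = c' C / s%:R.
  apply/eqP; rewrite eq_le; apply/andP; split.
    exact: leC c0 (esym e1) (esym e2) (esym e3) c'z.
  exact: leC c'0 e1 e2 e3 cz.
rewrite cC in e1 e2 e3.
move=> v; case: (boolP (v \in [:: C; P1; P2; P3])) => [|vN]; last first.
  by rewrite cN ?c'N.
rewrite !inE => /or4P[]/eqP ->; last 3 first.
- exact: addrI e1.
- exact: addrI e2.
- exact: addrI e3.
by apply: (mulIf (x := s%:R^-1)); rewrite ?invr_eq0 ?lt0r_neq0.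
Qed.

Lemma star_cone_sub k : star_index k -> cone (star_cone k) `<=` cone [:: P1; P2; P3].
Proof.
have s0 : 0 <= s%:R^-1 :> R by rewrite invr_ge0 ltW.
have Cc (a b c d : R) : 0 <= a -> 0 <= b -> 0 <= c -> 0 <= d ->
    cone [:: P1; P2; P3] (a *: C + b *: P1 + c *: P2 + d *: P3).
  move=> a0 b0 c0 d0; apply/cone3P.
  exists (a / s%:R + b), (a / s%:R * b2%:R + c), (a / s%:R * b3%:R + d).
  split; rewrite ?addr_ge0 ?mulr_ge0 //.
  by rewrite CE; apply/rowP => l; rewrite !mxE; field; exact: lt0r_neq0.
case=> [->|[-> _]|[-> _]] x /cone3P [a [b [c [a0 b0 c0 ->]]]].
- by have := Cc a 0 b c; rewrite scale0r addr0; apply.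
- have := Cc b a 0 c; rewrite scale0r addr0 [b *: C + _]addrC; exact.
- have := Cc c a b 0; rewrite scale0r addr0 -addrA addrC; exact.
Qed.

(** Subtract as much of [C] as possible: the generator to be replaced is the one with the smallest
    ratio among [c1], [c2 / b2] and [c3 / b3]. The comparisons are cross-multiplied because [b2] and
    [b3] may be zero. *)
Lemma star_cone_cover x : cone [:: P1; P2; P3] x ->
  exists2 k, star_index k & cone (star_cone k) x.
Proof.
move=> /cone3P [c1 [c2 [c3 [c10 c20 c30 ->]]]].
have sn0 := lt0r_neq0 sR_gt0.
have s0 := ltW sR_gt0.
have b20 : 0 <= b2%:R :> R by []; have b30 : 0 <= b3%:R :> R by [].
have pos b : 0 < b%:R :> R -> b <> 0%N by rewrite ltr0n; case: b.
have in2 : 0 < b2%:R :> R -> c2 <= b2%:R * c1 -> c2 * b3%:R <= c3 * b2%:R ->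
    exists2 k, star_index k &
      cone (star_cone k) (c1 *: P1 + c2 *: P2 + c3 *: P3).
  move=> bp le1 le2; exists 1%N; first by constructor 2; split=> //; exact: pos.
  apply/cone3P; exists (c1 - c2 / b2%:R), (s%:R * c2 / b2%:R),
    (c3 - b3%:R * c2 / b2%:R); split.
  - by rewrite subr_ge0 ler_pdivrMr // mulrC.
  - by rewrite divr_ge0 // mulr_ge0.
  - by rewrite subr_ge0 ler_pdivrMr // mulrC.
  - rewrite CE; apply/rowP => l; rewrite !mxE; field.
    by rewrite sn0 lt0r_neq0.
have in3 : 0 < b3%:R :> R -> c3 <= b3%:R * c1 -> c3 * b2%:R <= c2 * b3%:R ->
    exists2 k, star_index k &
      cone (star_cone k) (c1 *: P1 + c2 *: P2 + c3 *: P3).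
  move=> bp le1 le2; exists 2%N; first by constructor 3; split=> //; exact: pos.
  apply/cone3P; exists (c1 - c3 / b3%:R), (c2 - b2%:R * c3 / b3%:R),
    (s%:R * c3 / b3%:R); split.
  - by rewrite subr_ge0 ler_pdivrMr // mulrC.
  - by rewrite subr_ge0 ler_pdivrMr // mulrC.
  - by rewrite divr_ge0 // mulr_ge0.
  - rewrite CE; apply/rowP => l; rewrite !mxE; field.
    by rewrite sn0 lt0r_neq0.
have bpos (b c : R) : 0 <= b -> 0 <= c -> c < b * c1 -> 0 < b.
  move=> b0 c0 lt; rewrite lt_neqAle b0 andbT; apply/eqP => bz.
  by move: lt; rewrite -bz mul0r ltNge c0.
have [le2|lt2] := leP (b2%:R * c1) c2; have [le3|lt3] := leP (b3%:R * c1) c3.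
- exists 0%N; first by constructor 1.
  apply/cone3P; exists (s%:R * c1), (c2 - b2%:R * c1), (c3 - b3%:R * c1); split.
  - by rewrite mulr_ge0.
  - by rewrite subr_ge0.
  - by rewrite subr_ge0.
  - by rewrite CE; apply/rowP => l; rewrite !mxE; field.
- apply: in3; [exact: bpos lt3|exact: ltW|].
  have : c3 * b2%:R <= b3%:R * c1 * b2%:R by rewrite ler_wpM2r // ltW.
  have : b2%:R * c1 * b3%:R <= c2 * b3%:R by rewrite ler_wpM2r.
  nra.
- apply: in2; [exact: bpos lt2|exact: ltW|].
  have : c2 * b3%:R <= b2%:R * c1 * b3%:R by rewrite ler_wpM2r // ltW.
  have : b3%:R * c1 * b2%:R <= c3 * b2%:R by rewrite ler_wpM2r.
  nra.
- have [le23|lt23] := leP (c2 * b3%:R) (c3 * b2%:R).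
    by apply: in2 => //; [exact: bpos lt2|exact: ltW].
  by apply: in3; [exact: bpos lt3|exact: ltW|exact: ltW].
Qed.

End StarSubdivision.

(** Strong induction on the index [s]: replacing [P2] or [P3] by the Oka center lowers it to the
    corresponding residue, and all ages remain one. The star subdivision supplies the pieces to be
    glued. *)
Lemma FO_triangulation M P1 P2 P3 s E m2 m3 :
  (forall x, M x -> age x \is a Num.int) ->
  semi_unimodular_by M P1 P2 P3 s E m2 m3 ->
  (forall v, v \in [:: P1; P2; P3] -> age v = 1) ->
  triangulation M (FO_cone M P1 [:: P2; P3]) (cone [:: P1; P2; P3]).
Proof.
move=> M_age; have [N] := ubnP s.
elim: N s P2 P3 E m2 m3 => // N IH s P2 P3 E m2 m3 ltsN semiP age1.
have [s_gt0 basisE P1E] := semiP.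
have idx := semi_unimodular_index semiP.
have idx_uniq s' : cone_index M P1 [:: P2; P3] s' -> s' = s.
  by move=> idx'; apply: has_index_uniq idx' idx; exact: Zspan_subgroup.
have freeP := semi_unimodular_free semiP.
have [s1|s_neq1] := eqVneq s 1%N.
  have -> : FO_cone M P1 [:: P2; P3] = [set [:: P1; P2; P3]].
    apply/seteqP; split=> Q; last by move=> ->; apply: FO_unchanged; move: idx; rewrite s1.
    move=> /FO_coneE [[_ ->] //|[s' [b [C [[[idx' lt1] _ _ _ _] _]]]]].
    by move: lt1; rewrite (idx_uniq _ idx') s1.
  apply: triangulation_set1; split=> //.
  apply: (Zbasis_exchange basisE) => //= [v|v].
    exact: (semi_unimodular_mem semiP).
  rewrite !inE => /or3P[]/eqP ->; try by
    apply: mem_Zspan; rewrite !inE eqxx ?orbT.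
  apply/Zspan3P; exists 1, (- m2), (- m3); rewrite P1E s1.
  by apply/rowP => j; rewrite !mxE; ring.
have s_gt1 : (1 < s)%N by lia.
have [b [C oka]] := oka_center_exists semiP s_gt1.
have [_ b2s b3s CE] := oka_centerE semiP s_gt1 oka.
have C_age := oka_center_age semiP M_age age1 s_gt1 oka.
have [_ _ _ CM basisC] := oka.
pose QQ k := match k with 0%N => [set [:: C; P2; P3]]
  | 1%N => FO_cone M P1 [:: C; P3] | _ => FO_cone M P1 [:: P2; C] end.
(* Uniqueness of the Oka center is what makes every derivation of [FO_cone] pass through the same
   [C]. *)
have -> : FO_cone M P1 [:: P2; P3] =
    \bigcup_(k in star_index (b 0%N) (b 1%N)) QQ k.
  apply/seteqP; split=> Q.
    move=> /FO_coneE [[idx1 _]|[s' [b' [C' [oka']]]]].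
      by rewrite (idx_uniq _ idx1) eqxx in s_neq1.
    have [_ b2E b3E ->] := oka_center_uniq semiP s_gt1 oka' oka.
    case=> [->|[[|[|i]] [lti bi FO]]]; last by [].
    - by exists 0%N => //; constructor 1.
    - by exists 1%N => //; constructor 2; rewrite -b2E.
    - by exists 2%N => //; constructor 3; rewrite -b3E.
  case=> k [->|[-> b0]|[-> b0]] /= FO; apply/FO_coneE; right; exists s, b, C.
  - by split=> //; left.
  - by split=> //; right; exists 0%N.
  - by split=> //; right; exists 1%N.
have age_star k v : v \in star_cone P1 P2 P3 C k -> age v = 1.
  by case: k => [|[|k]]; rewrite !inE => /or3P[]/eqP -> //;
    rewrite age1 // !inE eqxx ?orbT.
have semi2 : b 0%N <> 0%N ->
    semi_unimodular_by M P1 C P3 (b 0%N) (- P2) s%:Z (- (b 1%N)%:Z).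
  by move=> /eqP; rewrite -lt0n => b0; exact: semi_unimodular_replace2 CE.
have semi3 : b 1%N <> 0%N ->
    semi_unimodular_by M P1 P2 C (b 1%N) (- P3) (- (b 0%N)%:Z) s%:Z.
  by move=> /eqP; rewrite -lt0n => b0; exact: semi_unimodular_replace3 CE.
apply: (triangulation_bigcup (q := star_cone P1 P2 P3 C)).
- apply: (sub_finite_set _ (finite_II 3)) => k /=.
  by case=> [->|[-> _]|[-> _]].
- move=> k kJ; split; last exact: (star_cone_sub s_gt1 CE kJ).
  + by case: kJ => [->|[-> _]|[-> _]].
  + case: kJ => [->|[-> /semi2]|[-> /semi3]]; first by case: basisC.
      exact: semi_unimodular_free.
    exact: semi_unimodular_free.
  + exact: age_star.
- exact: (star_compatible s_gt1 freeP CE).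
- exact: (star_cone_neq s_gt1 freeP CE).
- exact: (star_cone_cover s_gt1 CE).
case=> [|[|k]] kJ.
- by apply: triangulation_set1; split=> // v; exact: (age_star 0%N).
- have b0 : b 0%N <> 0%N by case: kJ => [//|[]//|[]//].
  apply: (IH _ _ _ _ _ _ _ (semi2 b0) (age_star 1%N)); lia.
- have b0 : b 1%N <> 0%N by case: kJ => [//|[]//|[]//].
  apply: (IH _ _ _ _ _ _ _ (semi3 b0) (age_star 2%N)); lia.
Qed.

End FujikiOkaSubdivision.

(** * One step of the chain *)

Section CyclicExtension.
Variables (R : realType) (n : nat).
Local Notation V := 'rV[R]_n.
Implicit Types (M : set V) (A B C E P v w x : V).

(** When [M] is a subgroup, this says that [M'] is [M + Z w]. *)
Definition cyclic_extension M M' w : Prop :=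
  [/\ subgroup_set M', M `<=` M', M' w
    & forall x, M' x -> exists z : int, M (x - z%:~R *: w)].

Lemma semi_unimodular_of_coprime M M' A B C w (N : nat) (a b c : int) :
  cyclic_extension M M' w -> Zbasis M [:: A; B; C] -> (0 < N)%N ->
  N%:R *: w = a%:~R *: A + b%:~R *: B + c%:~R *: C -> coprimez a N ->
  exists E m2 m3, semi_unimodular_by M' A B C N E m2 m3.
Proof.
move=> [M'sub MM' M'w M'E] basisM N_gt0 wE /eqP cop.
have NR0 : N%:R != 0 :> R by rewrite pnatr_eq0 -lt0n.
have [u [v uv]] := Bezoutz a N; rewrite cop in uv.
have uvR : v%:~R = (1 - u%:~R * a%:~R) / N%:R :> R.
  have uvR1 : u%:~R * a%:~R + v%:~R * N%:R = 1 :> R.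
    by rewrite [N%:R]pmulrn -!intrM -intrD uv.
  apply: (mulIf NR0); rewrite divfK //; apply/esym/eqP.
  by rewrite subr_eq addrC uvR1.
have wE' : w = N%:R^-1 *: (a%:~R *: A + b%:~R *: B + c%:~R *: C).
  by rewrite -wE scalerA mulVf // scale1r.
(* By the Bezout identity [u a + v N = 1], modulo [B] and [C] one has [A = N E] and [w = a E]. So
   [E] generates what [A] and [w] generate together. *)
pose E := u%:~R *: w + v%:~R *: A.
have AE : A = N%:R *: E + (- (u * b))%:~R *: B + (- (u * c))%:~R *: C.
  rewrite /E uvR wE'; apply/rowP => j; rewrite !mxE !intrN !intrM; field; exact: NR0.
have basisM_mem := Zbasis_mem basisM.
exists E, (- (u * b)), (- (u * c)); split=> //.
have Asp : Zspan [set` [:: E; B; C]] A.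
  by apply/Zspan3P; exists N%:Z, (- (u * b)), (- (u * c)); rewrite {1}AE -pmulrn.
have Bsp : Zspan [set` [:: E; B; C]] B by apply: mem_Zspan; rewrite !inE eqxx orbT.
have Csp : Zspan [set` [:: E; B; C]] C by apply: mem_Zspan; rewrite !inE eqxx !orbT.
have wsp : Zspan [set` [:: E; B; C]] w.
  apply/Zspan3P; exists a, (v * b), (v * c).
  rewrite /E !intrM uvR [LHS]wE' {1}wE'.
  by apply/rowP => j; rewrite !mxE; field; exact: NR0.
have spsub := Zspan_subgroup [set` [:: E; B; C]].
have [freeM Meq] := basisM.
split.
  apply: (free_exchange freeM) => // x; rewrite !inE => /or3P[]/eqP ->;
    exact: Zspan_sub_span.
apply/seteqP; split=> x.
  move=> /M'E [z]; rewrite Meq => xw; rewrite -[x](subrK (z%:~R *: w)).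
  apply: subgroup_setD => //; last by rewrite scaler_int; exact: subgroup_setMz.
  apply: (Zspan_min spsub) xw => y /=.
  by rewrite !inE => /or3P[]/eqP ->.
apply: Zspan_min => // y /=; rewrite !inE => /or3P[]/eqP ->.
- apply: subgroup_setD => //; rewrite scaler_int; apply: subgroup_setMz => //.
  by apply: MM'; apply: basisM_mem; rewrite inE eqxx.
- by apply: MM'; apply: basisM_mem; rewrite !inE eqxx orbT.
- by apply: MM'; apply: basisM_mem; rewrite !inE eqxx !orbT.
Qed.

(** Induction on [k] replaces the choice of a minimal prime power: a coefficient not divisible by
    [p] is already prime to the power, and if [p] divides all three, the relation can be divided by
    [p]. *)
Lemma semi_unimodular_exists M M' A B C w (p k : nat) :
  cyclic_extension M M' w -> Zbasis M [:: A; B; C] -> prime p ->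
  M ((p ^ k)%:R *: w) ->
  exists P1 P2 P3 s E m2 m3, perm_eq [:: A; B; C] [:: P1; P2; P3] /\
    semi_unimodular_by M' P1 P2 P3 s E m2 m3.
Proof.
move=> ext basisM p_pr; have [_ Meq] := basisM.
have p_gt0 := prime_gt0 p_pr.
elim: k => [|k IH] Mpw.
  have : M (1%:R *: w) by [].
  rewrite {1}Meq => /Zspan3P [a [b [c wE]]].
  have [E [m2 [m3 semiP]]] :=
    semi_unimodular_of_coprime ext basisM (ltn0Sn 0) wE (coprimen1 `|a|%N).
  by exists A, B, C, 1%N, E, m2, m3.
have := Mpw; rewrite {1}Meq => /Zspan3P [a [b [c wE]]].
have pk_gt0 : (0 < p ^ k.+1)%N by rewrite expn_gt0 p_gt0.
have cop (z : int) : ~~ (p%:Z %| z)%Z -> coprimez z (p ^ k.+1)%N.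
  by move=> pz; rewrite coprimezE /= coprimeXr // coprime_sym prime_coprime.
case: (boolP (p%:Z %| a)%Z) => [/dvdzP [a' aE]|/cop pa]; last first.
  have [E [m2 [m3 semiP]]] := semi_unimodular_of_coprime ext basisM pk_gt0 wE pa.
  by exists A, B, C, (p ^ k.+1)%N, E, m2, m3.
case: (boolP (p%:Z %| b)%Z) => [/dvdzP [b' bE]|/cop pb]; last first.
  have perm : perm_eq [:: A; B; C] [:: B; A; C].
    by rewrite (perm_catCA [:: A] [:: B] [:: C]).
  have basisM' := Zbasis_perm perm basisM.
  rewrite [X in X + _]addrC in wE.
  have [E [m2 [m3 semiP]]] := semi_unimodular_of_coprime ext basisM' pk_gt0 wE pb.
  by exists B, A, C, (p ^ k.+1)%N, E, m2, m3.
case: (boolP (p%:Z %| c)%Z) => [/dvdzP [c' cE]|/cop pc]; last first.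
  have perm : perm_eq [:: A; B; C] [:: C; A; B].
    by rewrite (perm_catC [:: A; B] [:: C]).
  have basisM' := Zbasis_perm perm basisM.
  rewrite addrC addrA in wE.
  have [E [m2 [m3 semiP]]] := semi_unimodular_of_coprime ext basisM' pk_gt0 wE pc.
  by exists C, A, B, (p ^ k.+1)%N, E, m2, m3.
apply: IH; rewrite {1}Meq; apply/Zspan3P; exists a', b', c'.
have pR : p%:R != 0 :> R by rewrite pnatr_eq0 -lt0n.
apply: (scalerI pR); rewrite scalerA -natrM -expnS wE aE bE cE.
by apply/rowP => j; rewrite !mxE !intrM -!pmulrn; ring.
Qed.

End CyclicExtension.

Section Step.
Variable (R : realType).
Local Notation V := 'rV[R]_3.
Implicit Types (M : set V) (Q : seq V) (A P v w x : V) (QQ : set (seq V)).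

Lemma triangulation_free M QQ X Q : triangulation M QQ X -> QQ Q -> free Q.
Proof. by move=> [_ h _ _] /h [[_ []]]. Qed.

Lemma triangulation_is_fan M QQ X :
  triangulation M QQ X -> is_fan M (fan_of QQ).
Proof.
move=> tri; have [finQ QQP compat _] := tri; apply: fan_of_is_fan => //.
  by move=> Q; exact: triangulation_free tri.
by move=> Q v /QQP [[_ basisQ _] _]; exact: Zbasis_mem.
Qed.

Lemma triangulation_crepant_resolution M QQ :
  triangulation M QQ (@orthant R 3) -> crepant_resolution M (fan_of QQ).
Proof.
move=> tri; have [finQ QQP compat cover] := tri.
have freeQ Q := @triangulation_free M QQ _ Q tri.
split; first exact: triangulation_is_fan tri.
- move=> _ /(fan_ofP freeQ _) [Q [S [QQQ ->]]].
  have [[_ basisQ _] _] := QQP Q QQQ.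
  by exists (seq.filter S Q), Q; split=> // v; rewrite mem_filter => /andP[].
- apply/seteqP; split=> x.
    case=> _ /(fan_ofP freeQ _) [Q [S [QQQ ->]]] Sx.
    have [_] := QQP Q QQQ; apply.
    have uQ := free_uniq (freeQ _ QQQ).
    have uS : uniq (seq.filter S Q) by rewrite filter_uniq.
    have [c /nonneg_comb_filter [cP _]] := (coneE x uS).1 Sx.
    by apply/coneE => //; exists c.
  by move=> /cover [Q QQQ Qx]; exists (cone Q) => //; exact: fan_of_cone.
move=> A [MA A0 Aprim] /(fan_ofP freeQ _) [Q [S [QQQ eqA]]].
have [[_ basisQ ageQ] _] := QQP Q QQQ.
have fQ := freeQ _ QQQ; have uQ := free_uniq fQ.
have AA : cone [:: A] A.
  exists (fun=> 1); split=> [_|]; first exact: ler01.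
  by rewrite big_ord_recl big_ord0 /= scale1r addr0.
rewrite eqA in AA; have uS : uniq (seq.filter S Q) by rewrite filter_uniq.
(* The ray is a face of some [Q], nonzero because [A] is. A generator [v] of this face is a multiple
   of [A], and the dual form of [v] takes an integral value on [A]; so [A] is a natural multiple of
   [v], and primitivity gives [A = v]. *)
have [v vS] : exists v, v \in seq.filter S Q.
  case: (seq.filter S Q) AA => [[c [_ AE]]|v s _]; last first.
    by exists v; rewrite inE eqxx.
  by case: A0; rewrite AE big_ord0.
have vQ : v \in Q by move: vS; rewrite mem_filter => /andP[].
have [u [uQv _ u_int]] := Zbasis_coord basisQ vQ.
have : cone [:: A] v by rewrite eqA; exact: mem_cone.
case=> c [c0]; rewrite big_ord_recl big_ord0 /= addr0.
set l := c ord0 => vE.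
have lu : l * pairing u A = 1.
  by have := uQv v vQ; rewrite eqxx {1}vE linearZ.
have l_neq0 : l != 0.
  by apply/eqP => l0; move: lu; rewrite l0 mul0r => /eqP; rewrite eq_sym oner_eq0.
have uA : pairing u A = l^-1 by rewrite -[RHS]mulr1 -lu mulKf.
have /intrP [z zE] := u_int A MA.
have : 0 < z%:~R :> R by rewrite -zE uA invr_gt0 lt_neqAle eq_sym l_neq0 c0.
case: z zE => [k|k] zE; rewrite ?NegzE ltr0z // => _.
have AE : A = v *+ k.
  by rewrite -scaler_nat pmulrn -zE uA vE scalerA mulVf // scale1r.
have k1 := Aprim v k (Zbasis_mem basisQ vQ) AE.
by rewrite /discrepancy AE k1 mulr1n ageQ // subrr.
Qed.

Lemma crepant_FO_step M M' w (p k : nat) QQ :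
  cyclic_extension M M' w -> prime p -> M ((p ^ k)%:R *: w) ->
  (forall x, M' x -> age x \is a Num.int) ->
  triangulation M QQ (@orthant R 3) ->
  exists QQ', triangulation M' QQ' (@orthant R 3) /\
    FO_step M' (fan_of QQ) (fan_of QQ').
Proof.
move=> ext p_pr Mpw M'_age tri; have [finQ QQP compat cover] := tri.
have freeQ Q := @triangulation_free M QQ _ Q tri.
have szQ Q : QQ Q -> size Q = 3%N by move=> /QQP [[]].
have maxP tau := maximal_cone_fan_of freeQ compat tau szQ.
(* The triple lists the distinguished generator first. The condition is vacuous off the maximal
   cones, where zeros are used, so that the choice is a total function as [FO_step] demands. *)
pose chosen tau (P : V * V * V) := maximal_cone (fan_of QQ) tau ->
  [/\ tau = cone [:: P.1.1; P.1.2; P.2],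
      exists2 Q, QQ Q & perm_eq Q [:: P.1.1; P.1.2; P.2] &
      exists s E m2 m3, semi_unimodular_by M' P.1.1 P.1.2 P.2 s E m2 m3].
have /choice [P PP] tau : exists P : V * V * V, chosen tau P.
  case: (pselect (maximal_cone (fan_of QQ) tau)) => [max|nmax]; last first.
    by exists (0, 0, 0).
  have [Q QQQ tauE] := (maxP tau).1 max.
  have [[_ basisQ _] _] := QQP Q QQQ.
  case: Q QQQ tauE (szQ Q QQQ) basisQ => [|A [|B [|C []]]] // QQQ tauE _ basisQ.
  have [P1 [P2 [P3 [s [E [m2 [m3 [perm semiP]]]]]]]] :=
    semi_unimodular_exists ext basisQ p_pr Mpw.
  exists (P1, P2, P3) => _; split=> /=; last by exists s, E, m2, m3.
    by rewrite tauE; apply: cone_perm => //; exact: free_uniq (freeQ _ QQQ).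
  by exists [:: A; B; C].
pose P1 tau := (P tau).1.1.
pose Ps tau := [:: (P tau).1.2; (P tau).2].
have freeP tau : maximal_cone (fan_of QQ) tau -> free (P1 tau :: Ps tau).
  by move=> /PP [_ [Q QQQ perm] _]; rewrite -(perm_free perm) freeQ.
have ageP tau v : maximal_cone (fan_of QQ) tau -> v \in P1 tau :: Ps tau ->
    age v = 1.
  move=> /PP [_ [Q QQQ perm] _]; rewrite -(perm_mem perm).
  by have [[_ _ ageQ] _] := QQP Q QQQ; exact: ageQ.
(* The union is indexed by cones, not by lists, since the choice of generators in [FO_step] depends
   on the cone only. *)
exists (\bigcup_(tau in maximal_cone (fan_of QQ)) FO_cone M' (P1 tau) (Ps tau)).
have tri' : triangulation M' (\bigcup_(tau in maximal_cone (fan_of QQ))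
    FO_cone M' (P1 tau) (Ps tau)) (@orthant R 3).
  apply: (triangulation_bigcup (q := fun tau => P1 tau :: Ps tau)).
  - apply: (sub_finite_set _ (finite_fan_of freeQ finQ)) => tau [] //.
  - move=> tau max; split=> //; first exact: freeP.
      by move=> v; exact: ageP.
    have [tauE [Q QQQ perm] _] := PP tau max.
    rewrite -(cone_perm (free_uniq (freeQ _ QQQ)) perm).
    by have [_] := QQP Q QQQ.
  - move=> tau tau' /PP [_ [Q QQQ perm] _] /PP [_ [Q' QQQ' perm'] _].
    by apply: compatible_perm perm perm' _; exact: compat.
  (* If all generators of [tau] were generators of [tau'], the two lists of three would be
     permutations of each other and the cones equal. *)
  - move=> tau tau' max max' tt'; apply: contrapT => no_v; apply: tt'.
    have [tauE _ _] := PP tau max; have [tauE' _ _] := PP tau' max'.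
    rewrite tauE tauE'; apply: cone_perm; first exact: free_uniq (freeP tau max).
    apply: uniq_perm; try by apply: free_uniq; exact: freeP.
    have sub : {subset P1 tau :: Ps tau <= P1 tau' :: Ps tau'}.
      move=> v vtau; apply: contrapT => /negP vtau'; apply: no_v.
      by exists v.
    by have [] := uniq_min_size (free_uniq (freeP tau max)) sub (leqnn 3).
  - move=> x /cover [Q QQQ Qx].
    have max : maximal_cone (fan_of QQ) (cone Q) by apply/maxP; exists Q.
    by exists (cone Q) => //; have [<- _ _] := PP _ max.
  - move=> tau max; have [_ _ [s [E [m2 [m3 semiP]]]]] := PP tau max.
    by apply: (FO_triangulation M'_age semiP) => v; exact: ageP.
split=> //; exists P1, Ps; split; last exact: triangulation_is_fan tri'.
- move=> tau max; have [tauE _ [s [E [m2 [m3 semiP]]]]] := PP tau max.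
  split=> //; split=> //; first exact: freeP.
    move=> v vP; apply: age_primitive => //; last exact: ageP vP.
    exact: (semi_unimodular_mem semiP).
  exists [:: E; (P tau).1.2; (P tau).2]; split; first by case: semiP.
  by move=> v vP; rewrite inE vP orbT.
- apply/seteqP; split=> F.
    by case=> Q [tau max FO] faceF; exists tau, Q.
  by case=> tau [Q [max FO faceF]]; exists Q => //; exists tau.
Qed.

Lemma orthant_triangulation M :
  (forall x, M x <-> forall j, x 0 j \is a Num.int) ->
  exists2 QQ, triangulation M QQ (@orthant R 3) & fan_of QQ = face (@orthant R 3).
Proof.
move=> MP.
pose i0 : 'I_3 := ord0; pose i1 : 'I_3 := lift ord0 ord0.
pose i2 : 'I_3 := lift ord0 (lift ord0 ord0).
pose Q : seq V := [:: delta_mx 0 i0; delta_mx 0 i1; delta_mx 0 i2].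
have xE x : x = x 0 i0 *: delta_mx 0 i0 + x 0 i1 *: delta_mx 0 i1 +
    x 0 i2 *: delta_mx 0 i2.
  by rewrite {1}[x]row_sum_delta !big_ord_recl big_ord0 addr0 addrA.
have I3 (j : 'I_3) : [\/ j = i0, j = i1 | j = i2].
  by case: j => [[|[|[|]]] lt3] //; [constructor 1|constructor 2|constructor 3];
    exact: val_inj.
have coordE (a b c : R) : let y : V := a *: delta_mx 0 i0 + b *: delta_mx 0 i1 +
    c *: delta_mx 0 i2 in [/\ y 0 i0 = a, y 0 i1 = b & y 0 i2 = c].
  by move=> y; rewrite /y !mxE /= !mulr1n !mulr0n !mulr0 !mulr1 !addr0 !add0r.
have freeQ : free Q.
  apply/(@freeP _ _ _ (in_tuple Q)) => k.
  rewrite !big_ord_recl big_ord0 /= addr0 addrA => eq0.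
  have := coordE (k ord0) (k (lift ord0 ord0)) (k (lift ord0 (lift ord0 ord0))).
  rewrite /= eq0 !mxE => -[k0 k1 k2].
  by case=> [[|[|[|]]] lt3] //; [rewrite [RHS]k0|rewrite [RHS]k1|rewrite [RHS]k2];
    congr k; exact: val_inj.
have coneQ : cone Q = @orthant R 3.
  apply/seteqP; split=> x.
    move=> /cone3P [a [b [c [a0 b0 c0 ->]]]] j.
    by have [e0 e1 e2] := coordE a b c; case: (I3 j) => ->; rewrite ?e0 ?e1 ?e2.
  by move=> x0; apply/cone3P; exists (x 0 i0), (x 0 i1), (x 0 i2); split.
exists [set Q]; last first.
  rewrite -coneQ; apply/seteqP; split=> F; first by case=> _ ->.
  by move=> faceF; exists Q.
rewrite -coneQ; apply: triangulation_set1; split=> //.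
  split=> //; apply/seteqP; split=> x.
    move=> /MP x_int; apply/Zspan3P.
    have /intrP [a aE] := x_int i0; have /intrP [b bE] := x_int i1.
    have /intrP [c cE] := x_int i2.
    by exists a, b, c; rewrite -aE -bE -cE; exact: xE.
  move=> /Zspan3P [a [b [c ->]]]; apply/MP => j.
  have [e0 e1 e2] := coordE a%:~R b%:~R c%:~R.
  by case: (I3 j) => ->; rewrite ?e0 ?e1 ?e2 intr_int.
move=> v vQ; have [k ->] : exists k : 'I_3, v = delta_mx 0 k.
  by move: vQ; rewrite !inE => /or3P[]/eqP ->; [exists i0|exists i1|exists i2].
rewrite /age (bigD1 k) //= big1 ?addr0 => [|j /negPf jk]; first by rewrite mxE !eqxx.
by rewrite mxE jk andbF.
Qed.

End Step.

(** * Diagonal groups and their lattices *)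

Section RootsOfUnity.
Variable R : realType.
Implicit Types x y : R.

Definition expi2pi x : R[i] := cos (2 * pi * x) +i* sin (2 * pi * x).

Lemma expi2piD x y : expi2pi (x + y) = expi2pi x * expi2pi y.
Proof.
rewrite /expi2pi mulrDr cosD sinD; apply/eqP; rewrite eq_complex /=.
by rewrite eqxx addrC eqxx.
Qed.

Lemma expi2pi0 : expi2pi 0 = 1.
Proof. by rewrite /expi2pi mulr0 cos0 sin0. Qed.

Lemma expi2piMn x k : expi2pi (x * k%:R) = expi2pi x ^+ k.
Proof.
elim: k => [|k IH]; first by rewrite mulr0 expi2pi0 expr0.
by rewrite -[k.+1]addn1 natrD mulrDr mulr1 expi2piD IH exprD expr1.
Qed.

Lemma expi2pi_sum (I : Type) (r : seq I) (F : I -> R) :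
  expi2pi (\sum_(i <- r) F i) = \prod_(i <- r) expi2pi (F i).
Proof. by apply: big_morph; [exact: expi2piD|exact: expi2pi0]. Qed.

(** Only the fractional part [y] matters. From [cos (2 * pi * y) = 1] one gets [sin (pi * y) = 0],
    impossible for [0 < y < 1]. *)
Lemma expi2pi_eq1 x : expi2pi x = 1 <-> x \is a Num.int.
Proof.
have e1 : expi2pi 1 = 1.
  rewrite /expi2pi mulr1 -[2 * pi]add0r mulr_natl cosD2pi cos0.
  by rewrite sinD2pi sin0.
have e_nat k : expi2pi k%:R = 1 by rewrite -[k%:R]mul1r expi2piMn e1 expr1n.
have e_int (z : int) : expi2pi z%:~R = 1.
  case: z => k; first by rewrite -pmulrn.
  rewrite NegzE mulrNz -[LHS]mul1r -{1}(e_nat k.+1) -expi2piD.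
  by rewrite pmulrn subrr expi2pi0.
split=> [ex|/intrP [z ->]] //.
pose y := x - (Num.floor x)%:~R.
have ey : expi2pi y = 1 by rewrite /y -mulrNz expi2piD ex e_int mulr1.
have /andP[y0 y1] : 0 <= y < 1.
  have /andP[f0 f1] := floor_itv x.
  by rewrite /y subr_ge0 f0 ltrBlDl -[X in _ + X]/(1%:~R) -intrD.
have [y_gt0|] := ltP 0 y; last first.
  move=> y_le0; have /eqP : y = 0 by apply/eqP; rewrite eq_le y0 y_le0.
  by rewrite subr_eq0 => /eqP ->; exact: intr_int.
have /eqP : cos (2 * pi * y) = 1.
  by move: ey => /eqP; rewrite eq_complex => /andP[/eqP].
rewrite -mulrA mulr_natl cos_mulr2n => cos1.
have : sin (pi * y) ^+ 2 = 0.
  by rewrite sin2cos2; move/eqP: cos1; lra.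
have : 0 < sin (pi * y).
  apply: sin_gt0_pi; rewrite mulr_gt0 ?pi_gt0 //=.
  by rewrite -[ltRHS]mulr1 ltr_pM2l ?pi_gt0.
by move=> sp /eqP; rewrite sqrf_eq0 gt_eqF.
Qed.

Lemma expi2pi_primitive (r : nat) : (0 < r)%N ->
  r.-primitive_root (expi2pi r%:R^-1).
Proof.
move=> r_gt0; have rR : 0 < r%:R :> R by rewrite ltr0n.
apply/andP; split=> //; apply/forallP => i; apply/eqP.
rewrite unity_rootE -expi2piMn; apply/eqP/eqP => [/expi2pi_eq1/intrP [z zE]|->].
  have {}zE : i.+1 = (z * r)%R :> int.
    apply/eqP; rewrite -(eqr_int R) intrM -!pmulrn -zE mulrAC mulVf ?mul1r //.
    exact: lt0r_neq0.
  have := ltn_ord i; case: z zE => [[|[|k]]|k] /=; nia.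
by rewrite mulVf ?lt0r_neq0 //; apply/expi2pi_eq1; exact: rpred1.
Qed.

Lemma root_of_unity_expi2pi (r : nat) (z : R[i]) : (0 < r)%N -> z ^+ r = 1 ->
  exists k : nat, z = expi2pi (k%:R / r%:R).
Proof.
move=> r_gt0 zr; have prim := expi2pi_primitive r_gt0.
have [k ->] := prim_rootP prim zr; exists k.
by rewrite mulrC expi2piMn.
Qed.

End RootsOfUnity.

(** * Simultaneous diagonalization of finite abelian matrix groups *)

Section Codiagonalization.
Variables (R : realType) (n' : nat).
Let n := n'.+1.

(** The minimal polynomial divides [X^r - 1], which splits over [R[i]] with distinct roots. *)
Lemma finite_order_diagonalizable (A : 'M[R[i]]_n) (r : nat) :
  (0 < r)%N -> A ^+ r = 1 -> diagonalizable A.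
Proof.
move=> r_gt0 Ar; apply/diagonalizableP.
have prim := expi2pi_primitive R r_gt0; set z := expi2pi _ in prim.
exists [seq z ^+ i | i <- index_iota 0 r].
  rewrite map_inj_in_uniq ?iota_uniq // => i j.
  rewrite !mem_index_iota => ir jr /eqP.
  by rewrite (eq_prim_root_expr prim) !modn_small // => /eqP.
rewrite big_map (factor_Xn_sub_1 prim); apply: mxminpoly_min.
by rewrite rmorphB rmorphXn rmorph1 /= horner_mx_X Ar subrr.
Qed.

Lemma abelian_repr_diagonalizes (gT : finGroupType) (G : {group gT})
    (rG : mx_representation R[i] G n) :
  abelian G -> exists P, diagonalizes rG P.
Proof.
move=> abG; pose As := [seq rG g | g <- enum G].
have [] : codiagonalizable As.
  apply/codiagonalizableP; split.
    move=> A B /mapP [g + ->] /mapP [h + ->]; rewrite !mem_enum => gG hG.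
    by rewrite /comm_mx -!repr_mxM // (centsP abG).
  move=> A /mapP [g + ->]; rewrite mem_enum => gG.
  apply: (finite_order_diagonalizable (order_gt0 g)).
  by rewrite -repr_mxX // expg_order repr_mx1.
move=> P Punit /allP PP; exists P; split=> // g gG.
have := PP (rG g); rewrite map_f ?mem_enum // => /(_ isT) /=.
by rewrite /conj_repr -(conjumx _ Punit).
Qed.

End Codiagonalization.

Section GroupLattice.
Variables (R : realType) (n : nat) (gT : finGroupType).
Variables (D : gT -> 'M[R[i]]_n) (G : {group gT}).
Hypothesis D1 : D 1%g = 1%:M.
Hypothesis DM : {in G &, forall g h, D (g * h)%g = D g *m D h}.
Hypothesis D_diag : forall g, g \in G -> is_diag_mx (D g).
Local Notation V := 'rV[R]_n.
Implicit Types (x y w : V) (g h : gT) (H : {group gT}).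

Definition expi2pi_mx x : 'M[R[i]]_n := diag_mx (\row_j expi2pi (x 0 j)).

Lemma expi2pi_mxD x y : expi2pi_mx (x + y) = expi2pi_mx x *m expi2pi_mx y.
Proof.
rewrite /expi2pi_mx mulmx_diag; congr diag_mx; apply/rowP => j.
by rewrite !mxE expi2piD.
Qed.

Lemma expi2pi_mx_eq1 x :
  expi2pi_mx x = 1%:M <-> forall j, x 0 j \is a Num.int.
Proof.
split=> [/matrixP eq1 j|x_int].
  by apply/expi2pi_eq1; have := eq1 j j; rewrite !mxE eqxx !mulr1n.
rewrite -diag_const_mx; congr diag_mx; apply/rowP => j; rewrite !mxE.
exact/expi2pi_eq1.
Qed.

Lemma expi2pi_mxDint x y : (forall j, y 0 j \is a Num.int) ->
  expi2pi_mx (x + y) = expi2pi_mx x.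
Proof. by move=> /expi2pi_mx_eq1 y1; rewrite expi2pi_mxD y1 mulmx1. Qed.

Lemma weight_mxE r (a : 'I_n -> nat) :
  weight_mx R r a = expi2pi_mx (weight_vec R r a).
Proof.
by congr diag_mx; apply/rowP => j; rewrite !mxE /expi2pi mulrA.
Qed.

Lemma diag_morphV h y : h \in G -> D h = expi2pi_mx y ->
  D h^-1%g = expi2pi_mx (- y).
Proof.
move=> hG Dh; rewrite -[LHS]mulmx1.
have <- : expi2pi_mx y *m expi2pi_mx (- y) = 1%:M.
  by rewrite -expi2pi_mxD subrr; apply/expi2pi_mx_eq1 => j; rewrite mxE rpred0.
by rewrite mulmxA -Dh -DM ?groupV // mulVg D1 mul1mx.
Qed.

Lemma diag_morphX h y k : h \in G -> D h = expi2pi_mx y ->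
  D (h ^+ k)%g = expi2pi_mx (k%:R *: y).
Proof.
move=> hG Dh; elim: k => [|k IH].
  rewrite expg0 scale0r D1; apply/esym/expi2pi_mx_eq1 => j.
  by rewrite mxE rpred0.
by rewrite expgS DM ?groupX // Dh IH -expi2pi_mxD -natr1 scalerDl scale1r addrC.
Qed.

(** Exhibits the lattice as the preimage of the group under the exponential map, so that facts on
    lattices reduce to facts on group elements. Conversely, if [D h] is the exponential of [x], the
    order [r] of [h] is a denominator of [x], and reducing [r x] modulo [r] splits [x] into a weight
    vector and an integral vector. *)
Lemma group_latticeP H x : H \subset G ->
  group_lattice D H x <-> exists2 h, h \in H & D h = expi2pi_mx x.
Proof.
move=> HG; have inG h : h \in H -> h \in G by apply: (fintype.subsetP HG).
have int_mx1 y : (forall j, y 0 j \is a Num.int) ->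
    exists2 h, h \in H & D h = expi2pi_mx y.
  by move=> y_int; exists 1%g => //; rewrite D1; apply/esym/expi2pi_mx_eq1.
split.
  apply: (Zspan_min (L := [set y | exists2 h, h \in H & D h = expi2pi_mx y])).
    split=> /=; first by apply: int_mx1 => j; rewrite mxE rpred0.
    move=> y y' [h hH Dh] [h' h'H Dh']; exists (h * h'^-1)%g.
      by rewrite groupM ?groupV.
    by rewrite DM ?groupV ?inG // (diag_morphV _ Dh') ?inG // Dh expi2pi_mxD.
  move=> y [[j ->]|[r [a [_ [h hH Dh] ->]]]] /=.
    by apply: int_mx1 => j'; rewrite mxE rpred_nat.
  by exists h => //; rewrite Dh weight_mxE.
move=> [h hH Dh]; pose r := #[h]%g; have r_gt0 : (0 < r)%N by exact: order_gt0.
have rR : r%:R != 0 :> R by rewrite pnatr_eq0 -lt0n.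
have rZ : r%:Z != 0 by case: r r_gt0 {rR}.
have /expi2pi_mx_eq1 rx_int : expi2pi_mx (r%:R *: x) = 1%:M.
  by rewrite -(diag_morphX _ (inG _ hH) Dh) expg_order D1.
have /choice [z zE] j : exists z : int, r%:R * x 0 j = z%:~R.
  by have := rx_int j; rewrite mxE => /intrP.
pose a j := `|(z j %% r%:Z)%Z|%N.
have aE j : z j = (z j %/ r%:Z)%Z * r%:Z + (a j)%:Z.
  by rewrite gez0_abs ?modz_ge0 //; exact: divz_eq.
pose y := \sum_j (z j %/ r%:Z)%Z%:~R *: (delta_mx 0 j : V).
have yE j : y 0 j = (z j %/ r%:Z)%Z%:~R.
  rewrite /y summxE (bigD1 j) //= big1 ?addr0 => [|k /negPf kj].
    by rewrite !mxE !eqxx mulr1.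
  by rewrite !mxE eq_sym kj mulr0.
have xE : x = weight_vec R r a + y.
  apply/rowP => j; rewrite !mxE yE; apply: (mulfI rR).
  by rewrite zE {1}aE intrD intrM mulrDr mulrCA mulfV // mulr1 addrC mulrC.
have Nsub := Zspan_subgroup (@std_basis R n `|` group_weights D H).
rewrite xE; apply: subgroup_setD => //.
  apply: sub_Zspan; right; exists r, a; split=> //.
    by move=> j; rewrite -ltz_nat gez0_abs ?modz_ge0 // ltz_pmod.
  exists h => //; rewrite weight_mxE Dh xE expi2pi_mxDint // => j.
  by rewrite yE intr_int.
apply: big_ind; first exact: Nsub.1.
  by move=> u v; exact: subgroup_setD.
move=> j _; rewrite scaler_int; apply: subgroup_setMz => //.
by apply: sub_Zspan; left; exists j.
Qed.

(** The diagonal entries are roots of unity of order dividing that of [g]. *)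
Lemma diag_weight_exists g : g \in G -> exists w, D g = expi2pi_mx w.
Proof.
move=> gG; have /is_diag_mxP diag := D_diag gG.
pose d := \row_j D g j j.
have Dd : D g = diag_mx d.
  apply/matrixP => i j; rewrite !mxE; case: eqVneq => [->|ij]; rewrite ?mulr1n //.
  by rewrite mulr0n diag.
have DX k : D (g ^+ k)%g = diag_mx (\row_j d 0 j ^+ k).
  elim: k => [|k IH].
    by rewrite expg0 D1 -diag_const_mx; congr diag_mx; apply/rowP => j; rewrite !mxE.
  rewrite expgS DM ?groupX // IH Dd mulmx_diag; congr diag_mx.
  by apply/rowP => j; rewrite !mxE exprS.
have d1 j : d 0 j ^+ #[g]%g = 1.
  have := DX #[g]%g; rewrite expg_order D1 => /matrixP/(_ j j).
  by rewrite !mxE eqxx !mulr1n.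
have /choice [k kP] j : exists k : nat, d 0 j = expi2pi (k%:R / #[g]%g%:R : R).
  by apply: root_of_unity_expi2pi (d1 j); exact: order_gt0.
exists (\row_j ((k j)%:R / #[g]%g%:R)); rewrite Dd; congr diag_mx.
by apply/rowP => j; rewrite [RHS]mxE kP mxE.
Qed.

(** The determinant of the exponential of [x] is [expi2pi (age x)]. *)
Lemma group_lattice_age H x : H \subset G ->
  (forall g, g \in G -> \det (D g) = 1) ->
  group_lattice D H x -> age x \is a Num.int.
Proof.
move=> HG D_det /(group_latticeP _ HG) [h hH Dh]; apply/expi2pi_eq1.
have := D_det h (fintype.subsetP HG h hH); rewrite Dh det_diag => <-.
by rewrite /age expi2pi_sum; apply: eq_bigr => j _; rewrite mxE.
Qed.

Lemma group_lattice1 x : group_lattice D (1%G : {group gT}) x <->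
  forall j, x 0 j \is a Num.int.
Proof.
rewrite group_latticeP ?sub1G //; split=> [[h /set1P -> /esym]|x_int].
  by rewrite D1 => /expi2pi_mx_eq1.
by exists 1%g; rewrite ?set11 // D1; apply/esym/expi2pi_mx_eq1.
Qed.

(** Here [w] is a logarithm of [D g]; if a lattice vector exponentiates to the image of
    [h * g ^+ m], subtracting [m] times [w] leaves a logarithm of [D h]. *)
Lemma group_lattice_extension H H' g : H' \subset G -> (H * <[g]>)%g = H' ->
  exists2 w, cyclic_extension (group_lattice D H) (group_lattice D H') w &
    group_lattice D H (#[g]%g%:R *: w).
Proof.
move=> H'G HgH'.
have HH' : H \subset H' by rewrite -HgH' mulG_subl.
have HG := fintype.subset_trans HH' H'G.
have gH' : g \in H' by rewrite -HgH' (fintype.subsetP (mulG_subr _ _)) ?cycle_id.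
have gG := fintype.subsetP H'G g gH'.
have [w Dw] := diag_weight_exists gG.
exists w; last first.
  apply/group_latticeP => //; exists 1%g => //.
  by rewrite -(diag_morphX _ gG Dw) expg_order.
split; first exact: Zspan_subgroup.
- move=> x /(group_latticeP _ HG) [h hH Dh]; apply/group_latticeP => //.
  by exists h => //; exact: fintype.subsetP HH' h hH.
- by apply/group_latticeP => //; exists g.
- move=> x /(group_latticeP _ H'G) [h' + Dhg].
  rewrite -HgH' => /mulsgP [h _ hH /cycleP [m ->] h'E]; exists m%:Z.
  rewrite {}h'E in Dhg.
  apply/group_latticeP => //; exists h => //.
  have hG := fintype.subsetP HG h hH.
  rewrite expi2pi_mxD -Dhg DM ?groupX // (diag_morphX _ gG Dw) -mulmxA.
  rewrite -expi2pi_mxD -pmulrn subrr.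
  have -> : expi2pi_mx 0 = 1%:M.
    by apply/expi2pi_mx_eq1 => j; rewrite mxE rpred0.
  by rewrite mulmx1.
Qed.

End GroupLattice.

(** * Decomposition of abelian groups into cyclic factors of prime power order *)

Section PrimaryDecomposition.
Variable gT : finGroupType.
Implicit Types (G K L : {group gT}) (b s : seq gT).

(** The operation [dprod] is partial: that the whole product is a group forces the two partial
    products to be genuine groups. *)
Lemma bigdprod_cycle_cat s1 s2 G :
  (\big[dprod/1]_(x <- s1 ++ s2) <[x]> = G)%g ->
  exists K L : {group gT}, [/\ (\big[dprod/1]_(x <- s1) <[x]> = K)%g,
    (\big[dprod/1]_(x <- s2) <[x]> = L)%g & (K \x L = G)%g].
Proof.
rewrite big_cat /= => dG; have [[K L eK eL] _ _ _] := dprodP dG.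
by exists K, L; rewrite -eK -eL.
Qed.

Lemma bigdprod_cycle_mem b G x :
  (\big[dprod/1]_(x <- b) <[x]> = G)%g -> x \in b -> x \in G.
Proof.
move=> dG xb; case/splitPr: xb dG => s1 s2 /bigdprod_cycle_cat [K [L [_ eL KL]]].
have [_ KLG _ _] := dprodP KL.
have LG : L \subset G by rewrite -KLG mulG_subr.
rewrite big_cons in eL; have [[_ L' _ eL'] KL' _ _] := dprodP eL.
apply: (fintype.subsetP LG); rewrite -KL' eL'.
by apply: (fintype.subsetP (mulG_subl L' <[x]>%g)); exact: cycle_id.
Qed.

(** Split off the [p]-core for a prime [p] dividing the order and recurse on its complement. Cyclic
    factors of a [p]-group have order a power of [p]. *)
Lemma abelian_primary_decomposition G : abelian G ->
  exists2 b, (\big[dprod/1]_(x <- b) <[x]> = G)%g &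
    forall x, x \in b -> exists p k, prime p /\ #[x]%g = (p ^ k)%N.
Proof.
have [N] := ubnP #|G|; elim: N G => // N IH G ltGN abG.
have [G1|ntG] := eqVneq #|G| 1%N.
  by exists [::] => //; rewrite big_nil; apply/esym/eqP; rewrite trivg_card1 G1.
pose p := pdiv #|G|.
have G_gt1 : (1 < #|G|)%N by rewrite ltn_neqAle eq_sym ntG cardG_gt0.
have p_pr : prime p := pdiv_prime G_gt1.
have dG := nilpotent_pcoreC p (abelian_nil abG).
have abp : abelian (pcore p G) := abelianS (pcore_sub _ _) abG.
have abp' : abelian (pcore (negn p) G) := abelianS (pcore_sub _ _) abG.
have [b1 dG1 _] := abelian_structure abp.
have ltp' : (#|(pcore (negn p) G)| < N)%N.
  apply: leq_trans (_ : #|G| <= N)%N; last by rewrite -ltnS.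
  apply: proper_card; rewrite properE pcore_sub /=; apply/negP => subG.
  have := pcore_pgroup (negn p) G; move/(pgroupS subG); rewrite /pgroup p'natE //.
  by rewrite pdiv_dvd.
have [b2 dG2 b2P] := IH _ ltp' abp'.
exists (b1 ++ b2); first by rewrite big_cat /= dG1 dG2.
move=> x; rewrite mem_cat => /orP[xb1|]; last exact: b2P.
have xO := bigdprod_cycle_mem dG1 xb1.
have /p_natP [k ->] := mem_p_elt (pcore_pgroup p G) xO.
by exists p, k.
Qed.

End PrimaryDecomposition.

(** * The chain of subgroups and its fans *)

Section Chain.
Variables (R : realType) (gT : finGroupType).
Variables (D : gT -> 'M[R[i]]_3) (G : {group gT}).
Hypothesis D1 : D 1%g = 1%:M.
Hypothesis DM : {in G &, forall g h, D (g * h)%g = D g *m D h}.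
Hypothesis D_diag : forall g, g \in G -> is_diag_mx (D g).
Hypothesis D_det : forall g, g \in G -> \det (D g) = 1.
Hypothesis G_abelian : abelian G.

(** The group [H i] is generated by the first [i] factors. Index 0 lies outside the chain proper;
    taking [H 0] trivial makes the first subdivision an instance of the general step, starting from
    the integral lattice. *)
Lemma primary_chain_exists : exists (k : nat) (H : nat -> {group gT}),
  [/\ (0 < k)%N /\ H k = G, H 0%N = 1%G, cyclic (H 1%N),
      forall i, (i < k)%N -> direct_factor (H i) (H i.+1) &
      forall i, (i < k)%N -> H i \subset G /\ H i.+1 \subset G /\
        exists g p e, [/\ (H i * <[g]>)%g = H i.+1, prime p & #[g]%g = (p ^ e)%N]].
Proof.
have [b0 dG0 b0P] := abelian_primary_decomposition G_abelian.
(* The trivial first factor makes the chain nonempty when G is trivial. *)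
pose b := 1%g :: b0.
have dG : (\big[dprod/1]_(x <- b) <[x]> = G)%g by rewrite big_cons cycle1 dprod1g.
have bP x : x \in b -> exists p e, prime p /\ #[x]%g = (p ^ e)%N.
  rewrite inE => /predU1P [->|]; last exact: b0P.
  by exists 2%N, 0%N; rewrite order1.
have /choice [H HP] i : exists K : {group gT},
    (\big[dprod/1]_(x <- take i b) <[x]> = K)%g /\ K \subset G.
  have [K [L [-> _ KL]]] : exists K L : {group gT},
      [/\ (\big[dprod/1]_(x <- take i b) <[x]> = K)%g,
        (\big[dprod/1]_(x <- drop i b) <[x]> = L)%g & (K \x L = G)%g].
    by apply: bigdprod_cycle_cat; rewrite cat_take_drop.
  by exists K; split=> //; have [_ <- _ _] := dprodP KL; exact: mulG_subl.
have HG i := (HP i).2; have dH i := (HP i).1.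
exists (size b), H; split.
- by split=> //; apply/group_inj; rewrite -dG -(dH (size b)) take_size.
- by apply/group_inj; rewrite -(dH 0%N) take0 big_nil.
- by rewrite -(dH 1%N) /= take0 big_seq1 cycle_cyclic.
- move=> i ltib; exists (take i b), [:: nth 1%g b i].
  by rewrite cats1 -take_nth.
move=> i ltib; split=> //; split=> //.
have [p [e [p_pr ord]]] := bP _ (mem_nth 1%g ltib).
exists (nth 1%g b i), p, e; split=> //.
have := dH i.+1; rewrite (take_nth 1%g) // -cats1 big_cat big_seq1 /= dH.
by case/dprodP.
Qed.

Lemma crepant_iterated_FO_diagonal : crepant_iterated_FO_exists D G.
Proof.
have [k [H [[k_gt0 HkG] H0 cycH1 dfH HP]]] := primary_chain_exists.
pose N i := group_lattice D (H i).
pose good i S := exists2 QQ, triangulation (N i) QQ (@orthant R 3) & S = fan_of QQ.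
(* The hypotheses are placed under the existential so that choice yields a total function [next],
   which can be iterated. Where they fail, [set0] is a dummy value. *)
have step (iS : nat * set (set 'rV[R]_3)) : exists S', (iS.1 < k)%N ->
    good iS.1 iS.2 -> FO_step (N iS.1.+1) iS.2 S' /\ good iS.1.+1 S'.
  case: iS => i S /=.
  have [[ltik [QQ triQQ ->]]|bad] := pselect ((i < k)%N /\ good i S); last first.
    by exists set0 => ltik gS; case: bad.
  have [HiG [HiG' [g [p [e [Hg p_pr ord]]]]]] := HP i ltik.
  have [w ext ordw] := group_lattice_extension D1 DM D_diag HiG' Hg.
  rewrite ord in ordw.
  have ageN x := group_lattice_age D1 DM HiG' D_det (x := x).
  have [QQ' [triQQ' stepQ]] := crepant_FO_step ext p_pr ordw ageN triQQ.
  by exists (fan_of QQ') => _ _; split=> //; exists QQ'.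
have /choice [next nextP] := step.
pose Sigma := fix Sigma i :=
  if i is j.+1 then next (j, Sigma j) else face (@orthant R 3).
have goodS i : (i <= k)%N -> good i (Sigma i).
  elim: i => [|i IH] ltik.
    have NP x : N 0%N x <-> forall j, x 0 j \is a Num.int.
      by rewrite /N H0; exact: (group_lattice1 D1 DM).
    by have [QQ triQQ eqS] := orthant_triangulation NP; exists QQ; rewrite ?eqS.
  by have [] := nextP (i, Sigma i) ltik (IH (ltnW ltik)).
exists k, H, Sigma; split.
  split=> //.
  - by move=> i /andP[_ ltik]; exact: dfH.
  - move=> i ltik.
    by have [] := nextP (i, Sigma i) ltik (goodS i (ltnW ltik)).
have [QQ triQQ ->] := goodS k (leqnn k).
by rewrite -HkG; exact: triangulation_crepant_resolution triQQ.
Qed.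

End Chain.

(* The finite abelian subgroup of SL(3,C), C = R[i], is the image of G under
   the faithful representation rG. *)
Theorem corollary4p4 (R : realType) (gT : finGroupType) (G : {group gT})
    (rG : mx_representation R[i] G 3)
    (rG_faithful : mx_faithful rG)
    (G_abelian : abelian G)
    (rG_SL : forall g, g \in G -> \det (rG g) = 1) :
  (exists P : 'M[R[i]]_3, diagonalizes rG P) /\
  (forall P : 'M[R[i]]_3, diagonalizes rG P ->
     crepant_iterated_FO_exists (conj_repr rG P) G).
Proof.
split=> [|P [Punit Pdiag]]; first exact: abelian_repr_diagonalizes.
apply: crepant_iterated_FO_diagonal => // [|g h gG hG|g gG].
- by rewrite /conj_repr repr_mx1 mulmx1 mulmxV.
- by rewrite /conj_repr repr_mxM // !mulmxA mulmxKV.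
- rewrite /conj_repr !det_mulmx rG_SL // mulr1 -det_mulmx mulmxV // det1 //.
Qed.
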